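(* Let $k$ be a perfect field of characteristic two. Let $s\in k$ be such that $x^3+sx+s$ is irreducible in $k[x]$ and $s=1+w+w^2$ for some $w\in k$. Let $\mathcal{N}=\big((k\times k\times k)\setminus\{(0,0,0)\}\big)\times(k/\mathrm{AS}(k))$, and for $(a,b,c,d)\in\mathcal{N}$ let $C^s_{abcd}$ be the smooth projective curve of genus two over $k$ with quasi-affine model $y^2+y=\frac{ax^2+bx+c}{x^3+sx+s}+d$. Let $\Gamma=\{x,\ \frac{wx+s}{x+w+1},\ \frac{(1+w)x+s}{x+w}\}\subseteq\mathrm{PGL}_2(k)$, a group isomorphic to $C_3$, acting on $\mathcal{N}$ by $$(a,b,c,d)^\gamma=\begin{cases}(a,b,c,d)&\text{if }\gamma(x)=x,\\ (a,b,c,d)M(w)&\text{if }\gamma(x)=\frac{wx+s}{x+w+1},\\ (a,b,c,d)M(w+1)&\text{if }\gamma(x)=\frac{(1+w)x+s}{x+w}.\end{cases}$$ 1. For any $(a,b,c,d),(a',b',c',d')\in\mathcal{N}$, the curves $C^s_{a'b'c'd'}$ and $C^s_{abcd}$ are $k$-isomorphic if and only if $(a',b',c',d')=(a,b,c,d)^\gamma$ for some $\gamma\in\Gamma$. 2. For any $(a,b,c,d)\in\mathcal{N}$ there is a split exact sequence $$1\to\langle\iota\rangle\to\mathrm{Aut}_k(C^s_{abcd})\to\Gamma_{abcd}\to1,$$ where $\Gamma_{abcd}$ is the isotropy group of $(a,b,c,d)$ under the action of $\Gamma$, and $\Gamma_{abcd}\simeq C_3$ if $a=b$ and $c=a(1+s)$,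 while $\Gamma_{abcd}$ is trivial otherwise.
   Context: For $w\in k$, $$M(w)=\begin{pmatrix} w^2+w^3&1+w^3&1+w+w^5&w^2\\ 1+w+w^2&w^2&1+w^2+w^4&w\\ 1+w&w&w^3&1\\ 0&0&0&1\end{pmatrix},$$ and $(a,b,c,d)M(w)$ is the product of a row vector with a matrix, the fourth coordinate being taken in $k/\mathrm{AS}(k)$. $\mathrm{AS}(k)=\{x+x^2 : x\in k\}$. The fourth coordinate $d$ of an element of $\mathcal{N}$ is a class in $k/\mathrm{AS}(k)$; in the equation of the curve one uses any representative in $k$, which does not change the $k$-isomorphism class, and comparisons of fourth coordinates are in $k/\mathrm{AS}(k)$. Elements of $\mathrm{PGL}_2(k)$ are written as fractional linear transformations $\gamma(x)$ of $\mathbb{P}^1$. The hyperelliptic involution is $\iota\colon(x,y)\mapsto(x,y+1)$. Every $k$-automorphism of such a curve has the form $(x,y)\mapsto(\gamma(x),y+v(x))$ with $\gamma\in\mathrm{PGL}_2(k)$, $v(x)\in k(x)$, and the right-hand map of the exact sequence sends it to $\gamma$. $C_3$ denotes the cyclic group of order 3. *)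

(* Defs.v *)
From HB Require Import structures.
From mathcomp Require Import all_boot all_order all_algebra separable qfpoly.
From mathcomp Require Import ring.
From mathcomp Require Import boolp classical_sets.

Set Implicit Arguments.
Unset Strict Implicit.
Unset Printing Implicit Defensive.

Import GRing.Theory.
Local Open Scope ring_scope.
Local Open Scope quotient_scope.

Definition perfect_field (k : fieldType) : Prop :=
  forall p : {poly k}, irreducible_poly p -> separable_poly p.

Section Groups.
Local Open Scope group_scope.

(* A subgroup of a possibly infinite group, as a group in its own right. *)
Inductive subgrp (G : groupType) (S : groupClosed G) : predArgType :=
  Subgrp (g : G) of g \in S.
Definition sgval (G : groupType) (S : groupClosed G) (u : subgrp S) : G :=
  let: Subgrp g _ := u in g.
HB.instance Definition _ (G : groupType) (S : groupClosed G) :=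
  [isSub for @sgval G S].
HB.instance Definition _ (G : groupType) (S : groupClosed G) :=
  [Choice of subgrp S by <:].
Fact groupClosed_closed (G : groupType) (S : groupClosed G) :
  group_closed (fun x : G => x \in S).
Proof. by split=> [|x y Sx Sy]; rewrite ?gpred1 ?gpredF. Qed.
HB.instance Definition _ (G : groupType) (S : groupClosed G) :=
  SubChoice_isSubGroup.Build G (fun x : G => x \in S) (subgrp S)
    (groupClosed_closed S).

(* The subgroup <g> generated by g: the intersection of the subgroups
   containing g. *)
Definition cyc (G : groupType) (g : G) : {pred G} :=
  fun h => `[< forall S : {pred G}, group_closed S -> g \in S -> h \in S >].
Fact cyc_closed (G : groupType) (g : G) : group_closed (cyc g).
Proof.
split=> [|x y /asboolP Sx /asboolP Sy]; apply/asboolP=> S clS gS.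
  by case: clS.
by apply: clS.2; [apply: Sx | apply: Sy].
Qed.
HB.instance Definition _ (G : groupType) (g : G) :=
  isMulClosed.Build G (cyc g) (group_closedM (cyc_closed g)).
HB.instance Definition _ (G : groupType) (g : G) :=
  isMul1Closed.Build G (cyc g) (cyc_closed g).1.
HB.instance Definition _ (G : groupType) (g : G) :=
  isInvClosed.Build G (cyc g) (group_closedV (cyc_closed g)).

Definition group_isomorphic (G H : groupType) : Prop :=
  exists f : {multiplicative G -> H}, bijective f.

(* The sequence 1 -> A -> B -> C -> 1 with maps i and p is exact and split. *)
Definition split_exact (A B C : groupType)
    (i : {multiplicative A -> B}) (p : {multiplicative B -> C}) : Prop :=
  [/\ injective i,
      forall b, p b = 1 <-> exists a, b = i a,
      forall c, exists b, p b = c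
    & exists sec : {multiplicative C -> B}, forall c, p (sec c) = c].

End Groups.

Section PGL2.
Variable k : fieldType.

Definition GL2 := {A : 'M[k]_2 | A \in unitmx}.

(* Equality up to a nonzero scalar, see pgl_relP. *)
Definition pgl_rel (A B : GL2) : bool :=
  is_scalar_mx (val A *m invmx (val B)).

Fact pgl_relP (A B : GL2) :
  reflect (exists c, val A = c *: val B) (pgl_rel A B).
Proof.
apply: (iffP is_scalar_mxP) => [[c E]|[c E]]; exists c.
  by rewrite -mul_scalar_mx -E mulmxKV //; exact: (valP B).
by rewrite E -scalemxAl mulmxV ?scalemx1 //; exact: (valP B).
Qed.

Fact pgl_rel_equiv : equiv_class_of pgl_rel.
Proof.
have nz (A B : GL2) c : val A = c *: val B -> c != 0.
  move=> E; apply/eqP=> c0; have := valP A; rewrite E c0 scale0r.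
  by rewrite unitmxE det0 unitr0.
have sym (A B : GL2) : pgl_rel A B -> pgl_rel B A.
  case/pgl_relP=> c E; apply/pgl_relP; exists c^-1.
  by rewrite E scalerA mulVf ?scale1r ?(nz _ _ _ E).
split=> [A|A B|B A C]; first by apply/pgl_relP; exists 1; rewrite scale1r.
  by apply/idP/idP; apply: sym.
case/pgl_relP=> c E /pgl_relP[d F]; apply/pgl_relP; exists (c * d).
by rewrite E F scalerA.
Qed.

Canonical pgl_equiv := EquivRelPack pgl_rel_equiv.
Canonical pgl_encModRel := defaultEncModRel pgl_rel.

Definition PGL2 := {eq_quot pgl_rel}.
HB.instance Definition _ := Choice.on PGL2.
HB.instance Definition _ := EqQuotient.on PGL2.

Definition GL2_one : GL2 := Sub 1%:M (unitmx1 _ _).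
Fact GL2_mul_subproof (A B : GL2) : val A *m val B \in unitmx.
Proof. by rewrite unitmx_mul (valP A) (valP B). Qed.
Definition GL2_mul (A B : GL2) : GL2 :=
  Sub (val A *m val B) (GL2_mul_subproof A B).
Fact GL2_inv_subproof (A : GL2) : invmx (val A) \in unitmx.
Proof. by rewrite unitmx_inv (valP A). Qed.
Definition GL2_inv (A : GL2) : GL2 := Sub (invmx (val A)) (GL2_inv_subproof A).

Definition PGL2_one : PGL2 := \pi_PGL2 GL2_one.
Definition PGL2_mul (u v : PGL2) : PGL2 := \pi_PGL2 (GL2_mul (repr u) (repr v)).
Definition PGL2_inv (u : PGL2) : PGL2 := \pi_PGL2 (GL2_inv (repr u)).

Fact PGL2_eqP (A B : GL2) :
  reflect (exists c, val A = c *: val B) (\pi_PGL2 A == \pi B).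
Proof. by rewrite piE; apply: pgl_relP. Qed.

Fact PGL2_reprP (A : GL2) : exists c, val (repr (\pi_PGL2 A)) = c *: val A.
Proof. by apply/PGL2_eqP; rewrite reprK. Qed.

Fact PGL2_mulE (A B : GL2) :
  PGL2_mul (\pi_PGL2 A) (\pi_PGL2 B) = \pi_PGL2 (GL2_mul A B).
Proof.
apply/eqP/PGL2_eqP; case: (PGL2_reprP A) (PGL2_reprP B) => [c Ec] [d Ed].
by exists (c * d); rewrite /= Ec Ed -scalemxAl -scalemxAr scalerA.
Qed.

Fact PGL2_pi_eq (A B : GL2) : val A = val B -> \pi_PGL2 A = \pi_PGL2 B.
Proof. by move/val_inj->. Qed.

Fact PGL2_mulA : associative PGL2_mul.
Proof.
move=> u v w; rewrite -[u]reprK -[v]reprK -[w]reprK !PGL2_mulE !reprK.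
by apply: PGL2_pi_eq; rewrite /= mulmxA.
Qed.
Fact PGL2_mul1 : left_id PGL2_one PGL2_mul.
Proof.
move=> u; rewrite -[u]reprK /PGL2_one PGL2_mulE.
by apply: PGL2_pi_eq; rewrite /= mul1mx.
Qed.
Fact PGL2_mulr1 : right_id PGL2_one PGL2_mul.
Proof.
move=> u; rewrite -[u]reprK /PGL2_one PGL2_mulE.
by apply: PGL2_pi_eq; rewrite /= mulmx1.
Qed.
Fact PGL2_mulV : left_inverse PGL2_one PGL2_inv PGL2_mul.
Proof.
move=> u; rewrite -{2}[u]reprK PGL2_mulE /PGL2_one.
by apply: PGL2_pi_eq; rewrite /= mulVmx // (valP (repr u)).
Qed.
Fact PGL2_mulrV : right_inverse PGL2_one PGL2_inv PGL2_mul.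
Proof.
move=> u; rewrite -{1}[u]reprK PGL2_mulE /PGL2_one.
by apply: PGL2_pi_eq; rewrite /= mulmxV // (valP (repr u)).
Qed.

HB.instance Definition _ := isGroup.Build PGL2
  PGL2_mulA PGL2_mul1 PGL2_mulr1 PGL2_mulV PGL2_mulrV.

End PGL2.

Local Open Scope classical_set_scope.

(* K is a function field in one variable over k (embedded by e): K is a finite
   extension of k(x) for some x transcendental over k.  Finiteness says that
   some finite family b spans K over k(x), with denominators cleared. *)
Definition function_field (k K : fieldType) (e : {rmorphism k -> K}) : Prop :=
  exists2 x : K, ~ algebraicOver e x &
    exists b : seq K, forall f : K, exists2 v : {poly k}, v != 0 &
      exists u : seq {poly k},
        (map_poly e v).[x] * f =
        \sum_(i < size b) (map_poly e u`_i).[x] * b`_i.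

(* A regular projective (integral) curve over k is determined by its function
   field K/k: its generic point has local ring K, its closed points are the
   discrete valuation rings of K/k (equivalently, the valuation rings O with
   k <= O < K), its proper closed subsets are the finite sets of closed points,
   and its structure sheaf sends U to the intersection of the local rings at the
   points of U.  Over a perfect field, regular means smooth. *)
Record curve (k : fieldType) := Curve {
  ffield : fieldType;
  fconst : {rmorphism k -> ffield};
  _ : function_field fconst }.

Section Curves.
Variable k : fieldType.

Record is_local_ring (C : curve k) (O : set (ffield C)) : Prop := IsLocalRing {
  lr_const : forall c : k, O (fconst C c);
  lr_sub : forall f g, O f -> O g -> O (f - g);
  lr_mul : forall f g, O f -> O g -> O (f * g);
  lr_valuation : forall f, O f \/ O f^-1;
  lr_proper : exists f, ~ O f }.

Definition point (C : curve k) := {O : set (ffield C) | is_local_ring O}.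

Definition regular (C : curve k) (f : ffield C) (P : point C) : Prop :=
  sval P f.

(* An isomorphism C -> D over k: a bijection phi of the closed points (hence a
   homeomorphism) with the map phis, f |-> f o phi, on rational functions, an
   isomorphism over k that identifies, for each P, the local ring of D at phi P
   with that of C at P. *)
Record is_curve_iso (C D : curve k)
    (phi : point C -> point D) (phis : ffield D -> ffield C) : Prop := {
  ci_point : bijective phi;
  ci_bij : bijective phis;
  ci_add : zmod_morphism phis;
  ci_mul : monoid_morphism phis;
  ci_const : forall c, phis (fconst D c) = fconst C c;
  ci_regular : forall f P, regular f (phi P) <-> regular (phis f) P }.

Record curve_iso (C D : curve k) := CurveIso {
  on_points : point C -> point D;
  pullback : ffield D -> ffield C;
  curve_isoP : is_curve_iso on_points pullback }.

Definition isomorphic (C D : curve k) : Prop := inhabited (curve_iso C D).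

Fact curve_iso_eq (C D : curve k) (f g : curve_iso C D) :
  on_points f =1 on_points g -> pullback f =1 pullback g -> f = g.
Proof.
case: f g => [f1 f2 fP] [g1 g2 gP] /= /funext E1 /funext E2.
by move: fP; rewrite E1 E2 => fP; rewrite (Prop_irrelevance fP gP).
Qed.

Fact is_curve_iso_id (C : curve k) : @is_curve_iso C C id id.
Proof. by split=> //; exists id. Qed.

Fact is_curve_iso_comp (C D E : curve k) f1 f2 g1 g2 :
  @is_curve_iso D E f1 f2 -> @is_curve_iso C D g1 g2 ->
  @is_curve_iso C E (f1 \o g1) (g2 \o f2).
Proof.
move=> F G; split.
- exact: bij_comp (ci_point F) (ci_point G).
- exact: bij_comp (ci_bij G) (ci_bij F).
- by move=> x y /=; rewrite (ci_add F) (ci_add G).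
- split=> [|x y] /=; first by rewrite (ci_mul F).1 (ci_mul G).1.
  by rewrite (ci_mul F).2 (ci_mul G).2.
- by move=> c /=; rewrite (ci_const F) (ci_const G).
- by move=> f P /=; rewrite (ci_regular F) (ci_regular G).
Qed.

Fact bijective_cid (A B : Type) (f : A -> B) :
  bijective f -> {g : B -> A | cancel f g /\ cancel g f}.
Proof. by move=> bf; apply: cid; case: bf => g fK gK; exists g. Qed.

Definition bij_inv (A B : Type) (f : A -> B) (bf : bijective f) : B -> A :=
  sval (bijective_cid bf).
Fact bij_invK (A B : Type) (f : A -> B) (bf : bijective f) :
  cancel f (bij_inv bf).
Proof. exact: (svalP (bijective_cid bf)).1. Qed.
Fact bij_invKV (A B : Type) (f : A -> B) (bf : bijective f) :
  cancel (bij_inv bf) f.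
Proof. exact: (svalP (bijective_cid bf)).2. Qed.

Fact is_curve_iso_inv (C D : curve k) f1 f2 (F : @is_curve_iso C D f1 f2) :
  @is_curve_iso D C (bij_inv (ci_point F)) (bij_inv (ci_bij F)).
Proof.
have K1 := bij_invK (ci_point F); have V1 := bij_invKV (ci_point F).
have K2 := bij_invK (ci_bij F); have V2 := bij_invKV (ci_bij F).
have I2 : injective f2 := can_inj K2.
split.
- by exists f1.
- by exists f2.
- by move=> x y; apply: I2; rewrite (ci_add F) !V2.
- split=> [|x y]; apply: I2; first by rewrite V2 (ci_mul F).1.
  by rewrite (ci_mul F).2 !V2.
- by move=> c; apply: I2; rewrite V2 (ci_const F).
- by move=> f P; rewrite -{2}[P]V1 (ci_regular F) V2.
Qed.

Definition Aut (C : curve k) := curve_iso C C.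
HB.instance Definition _ C := gen_eqMixin (Aut C).
HB.instance Definition _ C := gen_choiceMixin (Aut C).

Definition Aut_one C : Aut C := CurveIso (is_curve_iso_id C).
(* Composition of maps of curves: f * g is P |-> f (g P). *)
Definition Aut_mul C (f g : Aut C) : Aut C :=
  CurveIso (is_curve_iso_comp (curve_isoP f) (curve_isoP g)).
Definition Aut_inv C (f : Aut C) : Aut C :=
  CurveIso (is_curve_iso_inv (curve_isoP f)).

Fact Aut_mulA C : associative (@Aut_mul C).
Proof. by move=> f g h; apply: curve_iso_eq. Qed.
Fact Aut_mul1 C : left_id (Aut_one C) (@Aut_mul C).
Proof. by move=> f; apply: curve_iso_eq. Qed.
Fact Aut_mulr1 C : right_id (Aut_one C) (@Aut_mul C).
Proof. by move=> f; apply: curve_iso_eq. Qed.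
Fact Aut_mulV C : left_inverse (Aut_one C) (@Aut_inv C) (@Aut_mul C).
Proof.
by move=> f; apply: curve_iso_eq => x /=; rewrite (bij_invK, bij_invKV).
Qed.
Fact Aut_mulrV C : right_inverse (Aut_one C) (@Aut_inv C) (@Aut_mul C).
Proof.
by move=> f; apply: curve_iso_eq => x /=; rewrite (bij_invK, bij_invKV).
Qed.

HB.instance Definition _ C := isGroup.Build (Aut C)
  (@Aut_mulA C) (@Aut_mul1 C) (@Aut_mulr1 C) (@Aut_mulV C) (@Aut_mulrV C).

(* g(z) = (A00 z + A01) / (A10 z + A11) for g the class of the matrix A; it does
   not depend on the choice of A. *)
Definition mobius (C : curve k) (g : PGL2 k) (z : ffield C) : ffield C :=
  let A := val (repr g) in let c := fconst C in
  (c (A 0 0) * z + c (A 0 1)) / (c (A 1 0) * z + c (A 1 1)).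

End Curves.

Section QuadraticExtensions.

Fact horner_rmorph (k K : fieldType)
    (g : {rmorphism {poly k} -> K})
    (p : {poly k}) : (map_poly (g \o polyC) p).[g 'X] = g p.
Proof.
elim/poly_ind: p => [|p c IH]; first by rewrite !rmorph0 horner0.
by rewrite !rmorphD !rmorphM /= map_polyX map_polyC !hornerE IH.
Qed.

Fact fracP (k : fieldType) (r : {fraction {poly k}}) :
  exists u v, v != 0 /\ r * tofrac v = tofrac u.
Proof.
elim/quotW: r => x; exists (frac x).1, (frac x).2; split.
  exact: denom_ratioP.
rewrite !piE /FracField.mulf !numden_Ratio ?oner_eq0 // mulr1.
apply/eqP; rewrite piE /FracField.equivf /=.
by rewrite !numden_Ratio ?oner_eq0 ?denom_ratioP ?mulr1 // mulrC.
Qed.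


Section Quadratic.
Variables (F : fieldType) (h : {poly F}) (hI : monic_irreducible_poly h).

Definition qf_const : {rmorphism F -> {poly %/ h with hI}} := qpolyC h.

Fact qfpoly_quadratic (f : {poly %/ h with hI}) : size h = 3%N ->
  exists c0 c1, f = qf_const c0 + qf_const c1 * 'qX.
Proof.
move=> sz; pose f' : {poly %/ h} := f; pose g : {poly F} := f'.
have szm : size (mk_monic h) = 3%N by rewrite mk_monicE.
have sg : (size g < 3)%N by rewrite -szm; exact: size_mk_monic.
have cE c : in_qpoly h c%:P = qpolyC h c.
  apply: val_inj; rewrite [LHS]in_qpoly_small // szm size_polyC.
  by case: (c != 0).
exists g`_0, g`_1; change (f' = qpolyC h g`_0 + qpolyC h g`_1 * in_qpoly h 'X).
rewrite -!cE -rmorphM -rmorphD; apply: val_inj => /=.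
have Eg : g = (g`_0)%:P + (g`_1)%:P * 'X.
  apply/polyP=> [[|[|i]]]; rewrite !coefE /= ?mulr0 ?addr0 ?mulr1 ?add0r //.
  by apply: nth_default; rewrite -ltnS; apply: leq_trans sg _.
by rewrite -Eg Pdiv.CommonRing.rmodp_small // szm.
Qed.
End Quadratic.

Fact quadratic_function_field (k K : fieldType)
    (g : {rmorphism {fraction {poly k}} -> K}) (y : K) :
    (forall f, exists c0 c1, f = g c0 + g c1 * y) ->
  function_field (g \o (@tofrac {poly k} \o polyC)).
Proof.
move=> qf; pose gm : {rmorphism {poly k} -> K} := g \o (@tofrac {poly k}).
have gE p :
    (map_poly (g \o (@tofrac {poly k} \o polyC)) p).[g (tofrac 'X)] = g (tofrac p).
  exact: (horner_rmorph gm p).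
exists (g (tofrac 'X)).
  case=> p p0; rewrite /root gE fmorph_eq0 tofrac_eq0; exact/negP.
exists [:: 1; y] => f; have [c0 [c1 ->]] := qf f.
have [u0 [v0 [v0n E0]]] := fracP c0; have [u1 [v1 [v1n E1]]] := fracP c1.
exists (v0 * v1); first by rewrite mulf_neq0.
exists [:: u0 * v1; u1 * v0].
rewrite !big_ord_recl big_ord0 /= addr0 !gE mulr1.
rewrite !tofracM -E0 -E1 !rmorphM /=; ring.
Qed.

End QuadraticExtensions.

Section Family.
Variable k : fieldType.

Definition cubic (s : k) : {poly k} := 'X^3 + s *: 'X + s%:P.

(* The triples (a, b, c) <> (0, 0, 0), as row vectors. *)
Definition nz_triple := {t : 'rV[k]_3 | t != 0}.

Section Model.
Variables (s : k) (irr : irreducible_poly (cubic s)).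
(* d is any representative of the fourth coordinate. *)
Variables (t : nz_triple) (d : k).

Let kx := {fraction {poly k}}.
Let a := val t 0 0.
Let b := val t 0 1.
Let c := val t 0 2.

Definition quad : {poly k} := a *: 'X^2 + b *: 'X + c%:P.
Definition rhs : kx := tofrac quad / tofrac (cubic s) + tofrac d%:P.
Definition model : {poly kx} := 'X^2 + 'X - rhs%:P.

Fact size_cubic : size (cubic s) = 4%N.
Proof.
rewrite /cubic -addrA size_polyDl ?size_polyXn //.
rewrite (leq_ltn_trans (size_polyD _ _)) // gtn_max size_polyC.
rewrite (leq_ltn_trans (size_scale_leq _ _)) ?size_polyX //.
by case: (s != 0).
Qed.

Fact quad_neq0 : quad != 0.
Proof.
apply/eqP=> q0; case/negP: (valP t); apply/eqP/rowP=> i; rewrite mxE.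
have coq j : quad`_j = 0 by rewrite q0 coef0.
move: (coq 2) (coq 1%N) (coq 0%N).
rewrite /quad !coefE /= !(mulr0, mulr1, addr0, add0r) => a0 b0 c0.
case: i => [[|[|[|//]]] lti].
- by rewrite -[RHS]a0; congr (val t _ _); apply: val_inj.
- by rewrite -[RHS]b0; congr (val t _ _); apply: val_inj.
- by rewrite -[RHS]c0; congr (val t _ _); apply: val_inj.
Qed.

Fact size_quad : (size quad <= 3)%N.
Proof.
rewrite /quad -addrA (leq_trans (size_polyD _ _)) // geq_max.
rewrite (leq_trans (size_scale_leq _ _)) ?size_polyXn //=.
rewrite (leq_trans (size_polyD _ _)) // geq_max size_polyC.
rewrite (leq_trans (size_scale_leq _ _)) ?size_polyX //=.
by case: (c != 0).
Qed.

Fact frac_coprime (r : kx) :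
  exists u v, [/\ v != 0, coprimep u v & r * tofrac v = tofrac u].
Proof.
have [u [v [v0 E]]] := fracP r.
pose g := gcdp u v; have g0 : g != 0 by rewrite gcdp_eq0 negb_and v0 orbT.
have Eu : u %/ g * g = u by rewrite divpK ?dvdp_gcdl.
have Ev : v %/ g * g = v by rewrite divpK ?dvdp_gcdr.
exists (u %/ g), (v %/ g); split.
- by apply/eqP=> v'0; move: v0; rewrite -Ev v'0 mul0r eqxx.
- by apply: coprimep_div_gcd; rewrite v0 orbT.
have g0' : tofrac g != 0 :> kx by rewrite tofrac_eq0.
by apply: (mulIf g0'); rewrite -mulrA -!rmorphM /= Eu Ev.
Qed.

Fact irr_coprime (p : {poly k}) : ~~ (cubic s %| p) -> coprimep (cubic s) p.
Proof.
move=> ndvd; rewrite /coprimep; apply/negPn/negP=> sz.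
have /(_ sz) := irr.2 (gcdp (cubic s) p) _; move/(_ (dvdp_gcdl _ _)) => E.
by move: ndvd; rewrite -(eqp_dvdl _ E) dvdp_gcdr.
Qed.

Fact irr_sqr (p : {poly k}) : cubic s %| p * p -> cubic s %| p.
Proof.
move=> dvd; apply/negPn/negP=> /irr_coprime cop.
have cop2 : coprimep (cubic s) (p * p) by rewrite coprimepMr cop.
have /coprimepP/(_ _ (dvdpp _) dvd)/eqp_size := cop2.
by rewrite size_cubic size_poly1.
Qed.

Fact model_root (r : kx) : ~~ root model r.
Proof.
apply/negP; rewrite /root /model !(hornerE, hornerXn) subr_eq0 => /eqP Er.
have [u [v [v0 cop E]]] := frac_coprime r.
have q0 : cubic s != 0 by rewrite irredp_neq0.
have eqn : (u * u + u * v) * cubic s = v * v * (quad + d *: cubic s).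
  have q0' : tofrac (cubic s) != 0 :> kx by rewrite tofrac_eq0.
  have Eh : tofrac (quad + d *: cubic s) = rhs * tofrac (cubic s) :> kx.
    by rewrite /rhs mulrDl divfK // -mul_polyC rmorphD rmorphM.
  apply/eqP; rewrite -tofrac_eq 2!rmorphM /= Eh -Er; apply/eqP.
  move: (tofrac (cubic s)) => q; rewrite rmorphD !rmorphM /= -E; ring.
have cq : coprimep (cubic s) (quad + d *: cubic s).
  apply: irr_coprime; rewrite dvdp_addl -?mul_polyC ?dvdp_mull //.
  by apply/negP=> /(dvdp_leq quad_neq0);
    rewrite size_cubic leqNgt ltnS size_quad.
have dv : cubic s %| v.
  by apply: irr_sqr; rewrite -(Gauss_dvdpl _ cq) -eqn dvdp_mull.
have du : cubic s %| u.
  have : cubic s %| u * u + u * v.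
    have [z Ez] := dvdpP _ _ dv.
    have -> : u * u + u * v = z * (v * (quad + d *: cubic s)).
      by apply: (mulIf q0); rewrite eqn {1}Ez; ring.
    by rewrite dvdp_mull // dvdp_mulr.
  by rewrite (dvdp_addl _ (dvdp_mull u dv)); exact: irr_sqr.
have /coprimepP/(_ _ du dv)/eqp_size := cop.
by rewrite size_cubic size_poly1.
Qed.

Fact size_model : size model = 3%N.
Proof.
rewrite /model -addrA size_polyDl ?size_polyXn //.
by rewrite size_XsubC.
Qed.

Fact model_irreducible : monic_irreducible_poly model.
Proof.
split; first by apply: cubic_irreducible; rewrite ?size_model //;
  exact: model_root.
rewrite monicE /model -addrA lead_coefDl ?lead_coefXn //.
by rewrite size_polyXn size_XsubC.
Qed.

Let K : fieldType := {poly %/ model with model_irreducible}.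
Definition model_const : {rmorphism k -> K} :=
  qf_const model_irreducible \o (@tofrac {poly k} \o polyC).

Fact model_function_field : function_field model_const.
Proof.
apply: (@quadratic_function_field k K (qf_const model_irreducible) 'qX) => f.
by apply: qfpoly_quadratic; rewrite size_model.
Qed.

(* The smooth projective curve with quasi-affine model
   y^2 + y = (a x^2 + b x + c) / (x^3 + s x + s) + d, and the rational functions
   x and y on it. *)
Definition model_curve : curve k := Curve model_function_field.
Definition model_x : ffield model_curve :=
  qf_const model_irreducible (tofrac 'X).
Definition model_y : ffield model_curve := ('qX : K).

Fact model_equation (e := fconst model_curve) (x := model_x) (y := model_y) :
  y ^+ 2 + y = (e a * x ^+ 2 + e b * x + e c) / (x ^+ 3 + e s * x + e s) + e d.
Proof.
pose g : {rmorphism kx -> K} := qf_const model_irreducible.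
have -> : y ^+ 2 + y = g rhs.
  apply/eqP; rewrite -subr_eq0; apply/eqP.
  have gE c0 : in_qpoly model c0%:P = g c0.
    apply: val_inj; rewrite [LHS]in_qpoly_small //.
    rewrite (mk_monicE model_irreducible) size_model size_polyC.
    exact: leq_ltn_trans (leq_b1 _) _.
  rewrite -gE; have: in_qpoly model model = 0.
    apply: val_inj; rewrite /= (mk_monicE model_irreducible).
    exact: (Pdiv.RingMonic.rmodpp model_irreducible.2).
  by rewrite [X in in_qpoly _ X = _ -> _]/model rmorphB rmorphD rmorphXn.
have eE z : e z = g (tofrac z%:P) by [].
have xE : x = g (tofrac 'X) by [].
rewrite !eE xE /rhs /quad /cubic -!mul_polyC.
by rewrite !(rmorphD, rmorphM, fmorphV, rmorphXn) /=.
Qed.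

End Model.
End Family.

Section Action.
Variables (k : fieldType) (char2 : 2%N \in [pchar k]).

Definition mx_of_rows (m n : nat) (rows : seq (seq k)) : 'M[k]_(m, n) :=
  \matrix_(i < m, j < n) nth 0 (nth [::] rows i) j.

(* The subgroup {x + x^2 : x in k} of k. *)
Definition AS of 2%N \in [pchar k] : {pred k} :=
  fun d => `[< exists x, d = x + x ^+ 2 >].

Fact AS_closed : zmod_closed (AS char2).
Proof.
have two : 2%:R = 0 :> k by exact: pcharf0 char2.
split=> [|d d' /asboolP[x ->] /asboolP[x' ->]]; apply/asboolP.
  by exists 0; rewrite expr0n add0r.
exists (x + x'); rewrite (oppr_pchar2 char2); ring: two.
Qed.
HB.instance Definition _ :=
  GRing.isZmodClosed.Build k (AS char2) AS_closed.

Definition kmodAS := Quotient.quot (AS char2).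
HB.instance Definition _ := GRing.Zmodule.on kmodAS.

Definition calN : choiceType := (nz_triple k * kmodAS)%type.

Definition M (w : k) : 'M[k]_(3 + 1) := mx_of_rows 4 4
  [:: [:: w ^+ 2 + w ^+ 3; 1 + w ^+ 3; 1 + w + w ^+ 5; w ^+ 2];
      [:: 1 + w + w ^+ 2; w ^+ 2; 1 + w ^+ 2 + w ^+ 4; w];
      [:: 1 + w; w; w ^+ 3; 1];
      [:: 0; 0; 0; 1]].

Definition row4 (n : calN) : 'rV[k]_(3 + 1) :=
  row_mx (val n.1) (repr n.2)%:M.

Fact small_even :
  [/\ 12%:R = 0 :> k, 10%:R = 0 :> k,
      8%:R = 0 :> k, 6%:R = 0 :> k & 4%:R = 0 :> k].
Proof.
have even n : (n + n)%N%:R = 0 :> k by rewrite natrD (addrr_pchar2 char2).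
by split; [exact: (even 6) | exact: (even 5) | exact: (even 4)
         | exact: (even 3) | exact: (even 2)].
Qed.

Fact eq_char2 (x y : k) : x + y = 0 -> x = y.
Proof. by move/eqP; rewrite addr_eq0 (oppr_pchar2 char2) => /eqP. Qed.

Fact exp_succ (w : k) :
  [/\ (w + 1) ^+ 2 = w ^+ 2 + 1, (w + 1) ^+ 3 = w ^+ 3 + w ^+ 2 + w + 1,
      (w + 1) ^+ 4 = w ^+ 4 + 1 & (w + 1) ^+ 5 = w ^+ 5 + w ^+ 4 + w + 1].
Proof.
have [twelve ten eight six four] := small_even.
have two : 2%:R = 0 :> k by exact: pcharf0 char2.
by split; apply: eq_char2;
  ring: twelve ten eight six four two.
Qed.

Fact M_sqr (w : k) : M w *m M w = M (w + 1).
Proof.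
have [twelve ten eight six four] := small_even.
have two : 2%:R = 0 :> k by exact: pcharf0 char2.
have [e2 e3 e4 e5] := exp_succ w.
apply/matrixP=> i j; rewrite mxE !big_ord_recl big_ord0 !mxE /=.
case: i => [[|[|[|[|//]]]] ?]; case: j => [[|[|[|[|//]]]] ?] /=;
  rewrite ?(e2, e3, e4, e5); apply: eq_char2;
  ring: twelve ten eight six four two.
Qed.

Fact M_inv (w : k) : M w *m M (w + 1) = 1%:M.
Proof.
have [twelve ten eight six four] := small_even.
have two : 2%:R = 0 :> k by exact: pcharf0 char2.
have [e2 e3 e4 e5] := exp_succ w.
apply/matrixP=> i j; rewrite mxE !big_ord_recl big_ord0 !mxE /=.
case: i => [[|[|[|[|//]]]] ?]; case: j => [[|[|[|[|//]]]] ?] /=;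
  rewrite ?(e2, e3, e4, e5); apply: eq_char2; ring: twelve ten eight six four two.
Qed.


Fact M_blocks (w : k) :
  M w = block_mx (ulsubmx (M w)) (ursubmx (M w)) 0 1%:M :> 'M_(3 + 1).
Proof.
rewrite -[LHS]submxK; congr block_mx; apply/matrixP=> i j; rewrite !mxE /=.
  by case: i => [[|//] ?]; case: j => [[|[|[|//]]] ?].
by case: i => [[|//] ?]; case: j => [[|//] ?].
Qed.

Fact M_sqr_blocks (w : k)
    (A := fun w => ulsubmx (M w)) (u := fun w => ursubmx (M w)) :
  A w *m A w = A (w + 1) /\ A w *m u w + u w = u (w + 1).
Proof.
have := M_sqr w; rewrite (M_blocks w) (M_blocks (w + 1)).
rewrite (mulmx_block (A w) (u w) 0 1%:M (A w) (u w) 0 1%:M).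
by rewrite !mulmx0 mulmx1 addr0 => /eq_block_mx[].
Qed.

Fact M_inv_blocks (w : k)
    (A := fun w => ulsubmx (M w)) (u := fun w => ursubmx (M w)) :
  A w *m A (w + 1) = 1%:M /\ A w *m u (w + 1) + u w = 0.
Proof.
have := M_inv w; rewrite (M_blocks w) (M_blocks (w + 1)) -[1%:M in RHS]submxK.
rewrite (mulmx_block (A w) (u w) 0 1%:M (A (w + 1)) (u (w + 1)) 0 1%:M).
rewrite !mulmx0 mulmx1 addr0 => /eq_block_mx[-> -> _ _]; split.
  by apply/matrixP=> i j; rewrite !mxE -!val_eqE.
by apply/matrixP=> i j; rewrite !mxE -!val_eqE /=;
  case: i => [[|[|[|//]]] ?]; case: j => [[|//] ?].
Qed.

Fact row4_M (n : calN) (w : k) :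
  row4 n *m M w = row_mx (val n.1 *m ulsubmx (M w))
    (val n.1 *m ursubmx (M w) + (repr n.2)%:M).
Proof.
rewrite [M w in LHS]M_blocks /row4 (mul_row_block (val n.1) (repr n.2)%:M).
by rewrite mulmx0 addr0 mulmx1.
Qed.

Fact rowM_neq0 (n : calN) (w : k) : lsubmx (row4 n *m M w) != 0.
Proof.
rewrite row4_M row_mxKl; apply/eqP=> E; case/negP: (valP n.1).
by rewrite -[val _]mulmx1 -(M_inv_blocks w).1 mulmxA E mul0mx.
Qed.

(* (a, b, c, d) M(w); the class of the last coordinate does not depend on the
   representative of d used in row4, see actM2. *)
Definition actM (w : k) (n : calN) : calN :=
  (Sub (lsubmx (row4 n *m M w)) (rowM_neq0 n w),
   \pi_kmodAS (rsubmx (row4 n *m M w) 0 0)).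

Fact actM1 (w : k) (n : calN) : val (actM w n).1 = val n.1 *m ulsubmx (M w).
Proof. by rewrite /= row4_M row_mxKl. Qed.

Fact actM2 (w : k) (n : calN) :
  (actM w n).2 = \pi_kmodAS ((val n.1 *m ursubmx (M w)) 0 0) + n.2.
Proof.
rewrite /= row4_M row_mxKr mxE [(_%:M) 0 0]mxE mulr1n raddfD /=.
by rewrite reprK.
Qed.

Fact actM_sqr (w : k) (n : calN) : actM w (actM w n) = actM (w + 1) n.
Proof.
have [Es Et] := M_sqr_blocks w; apply: injective_projections.
  by apply: val_inj; rewrite !actM1 -mulmxA Es.
rewrite !actM2 !actM1 addrA -raddfD /= -Et mulmxDr mulmxA.
by rewrite [in RHS]mxE.
Qed.

Fact actM_inv (w : k) (n : calN) : actM (w + 1) (actM w n) = n.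
Proof.
have [Es Et] := M_inv_blocks w; apply: injective_projections.
  by apply: val_inj; rewrite !actM1 -mulmxA Es mulmx1.
rewrite !actM2 !actM1 addrA -raddfD /= -mulmxA.
rewrite (_ : _ + _ =
  (val n.1 *m (ulsubmx (M w) *m ursubmx (M (w + 1)) + ursubmx (M w))) 0 0).
  by rewrite Et mulmx0 mxE raddf0 add0r.
by rewrite mulmxDr [in RHS]mxE.
Qed.

(* The class of an invertible matrix A (of 1 if A is singular). *)
Definition pgl (A : 'M[k]_2) : PGL2 k := \pi_(PGL2 k) (insubd (GL2_one k) A).

Variables (s w : k).

Definition gamma1 : PGL2 k :=
  pgl (mx_of_rows 2 2 [:: [:: w; s]; [:: 1; w + 1]]).
Definition gamma2 : PGL2 k :=
  pgl (mx_of_rows 2 2 [:: [:: 1 + w; s]; [:: 1; w]]).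

Definition Gamma : {pred PGL2 k} :=
  [pred g | g \in [:: 1%g; gamma1; gamma2]].

(* (a, b, c, d)^g for g in Gamma; the last branch is for g outside Gamma. *)
Definition act (n : calN) (g : PGL2 k) : calN :=
  if g == 1%g then n
  else if g == gamma1 then actM w n
  else if g == gamma2 then actM (w + 1) n
  else n.

Variable hs : s = 1 + w + w ^+ 2.


(* The stabilizer of n in Gamma; the equation for s makes it a subgroup. *)
Definition isotropy of s = 1 + w + w ^+ 2 : calN -> {pred PGL2 k} :=
  fun n g => (g \in Gamma) && (act n g == n).

Let mx1 : 'M[k]_2 := mx_of_rows 2 2 [:: [:: w; s]; [:: 1; w + 1]].
Let mx2 : 'M[k]_2 := mx_of_rows 2 2 [:: [:: 1 + w; s]; [:: 1; w]].

Fact mx12 : mx1 *m mx2 = 1%:M /\ mx1 *m mx1 = mx2.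
Proof.
have [twelve ten eight six four] := small_even.
have two : 2%:R = 0 :> k by exact: pcharf0 char2.
split; apply/matrixP=> i j; rewrite mxE !big_ord_recl big_ord0 !mxE /=;
case: i => [[|[|//]] ?]; case: j => [[|[|//]] ?] /=; rewrite ?hs;
  apply: eq_char2; ring: twelve ten eight six four two.
Qed.

Fact mx1_unit : mx1 \in unitmx. Proof. by have [/mulmx1_unit[]] := mx12. Qed.
Fact mx2_unit : mx2 \in unitmx. Proof. by have [/mulmx1_unit[]] := mx12. Qed.

Fact pglE (A : 'M[k]_2) (uA : A \in unitmx) : pgl A = \pi_(PGL2 k) (Sub A uA).
Proof. by rewrite /pgl /insubd insubT. Qed.

Fact gamma12 : (gamma1 * gamma2 = 1)%g.
Proof.
rewrite /gamma1 /gamma2 (pglE mx1_unit) (pglE mx2_unit).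
rewrite [LHS]PGL2_mulE; apply: PGL2_pi_eq; exact: mx12.1.
Qed.

Fact gamma11 : (gamma1 * gamma1 = gamma2)%g.
Proof.
rewrite /gamma1 /gamma2 (pglE mx1_unit) (pglE mx2_unit).
rewrite [LHS]PGL2_mulE; apply: PGL2_pi_eq; exact: mx12.2.
Qed.

Fact gamma1_neq1 : gamma1 != 1%g.
Proof.
rewrite /gamma1 (pglE mx1_unit); apply/PGL2_eqP => -[c].
move/matrixP/(_ 1 0); rewrite !mxE /= mulr0 => /eqP.
by rewrite oner_eq0.
Qed.

Fact gamma2_neq : gamma2 != 1%g /\ gamma2 != gamma1.
Proof.
split; apply: contra_neq gamma1_neq1 => E; first by rewrite -gamma12 E mulg1.
by rewrite -gamma12 E gamma11 E.
Qed.

Fact act1 n : act n 1%g = n. Proof. by rewrite /act eqxx. Qed.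
Fact actg1 n : act n gamma1 = actM w n.
Proof. by rewrite /act (negPf gamma1_neq1) eqxx. Qed.
Fact actg2 n : act n gamma2 = actM (w + 1) n.
Proof. by rewrite /act !(negPf (gamma2_neq.1), negPf gamma2_neq.2) eqxx. Qed.

Fact GammaP g : reflect [\/ g = 1%g, g = gamma1 | g = gamma2] (g \in Gamma).
Proof.
by rewrite !inE; apply: (iffP or3P) => -[/eqP|/eqP|/eqP] H;
  [apply: Or31|apply: Or32|apply: Or33|apply: Or31|apply: Or32|apply: Or33];
  rewrite ?H.
Qed.

Fact isotropyP n g :
  reflect (g = 1%g \/ g \in Gamma /\ actM w n = n) (g \in isotropy hs n).
Proof.
have E : (actM (w + 1) n == n) = (actM w n == n).
  apply/eqP/eqP=> E; last by rewrite -actM_sqr !E.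
  by have := actM_inv w n; rewrite -actM_sqr (actM_sqr w n) E.
apply: (iffP andP) => [[Gg /eqP]|[->|[Gg /eqP fix_n]]].
- case/GammaP: (Gg) => ->; first by left.
    by rewrite actg1 => fix_n; right; split=> //; apply/GammaP/Or32.
  by rewrite actg2 => /eqP; rewrite E => /eqP; right;
    split=> //; apply/GammaP/Or33.
- by rewrite act1; split=> //; apply/GammaP/Or31.
split; first exact: Gg.
case/GammaP: (Gg) => ->; first by rewrite act1.
  by rewrite actg1; exact: fix_n.
by rewrite actg2 E; exact: fix_n.
Qed.

Fact gamma21 : (gamma2 * gamma1 = 1)%g.
Proof. by rewrite -gamma11 -mulgA gamma11 gamma12. Qed.

Fact gamma22 : (gamma2 * gamma2 = gamma1)%g.
Proof. by rewrite -{1}gamma11 -mulgA gamma12 mulg1. Qed.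

Fact Gamma_closed : group_closed Gamma.
Proof.
have V1 : (gamma1^-1 = gamma2)%g by rewrite -[LHS]mulg1 -gamma12 mulKg.
have V2 : (gamma2^-1 = gamma1)%g by rewrite -[LHS]mulg1 -gamma21 mulKg.
split=> [|u v /GammaP[]-> /GammaP[]->]; apply/GammaP;
  rewrite ?invg1 ?V1 ?V2 ?mul1g ?mulg1 ?gamma11 ?gamma12 ?gamma21 ?gamma22;
  by [apply: Or31|apply: Or32|apply: Or33].
Qed.

Fact act_mul n g h : g \in Gamma -> h \in Gamma ->
  act n (g * h)%g = act (act n g) h.
Proof.
move=> /GammaP[]-> /GammaP[]->;
  rewrite ?mul1g ?mulg1 ?gamma11 ?gamma12 ?gamma21 ?gamma22
          ?act1 ?actg1 ?actg2 ?act1 ?actM_sqr ?actM_inv //.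
  by rewrite -actM_sqr actM_sqr actM_inv.
by rewrite -addrA (addrr_pchar2 char2) addr0.
Qed.

Fact isotropy_closed n : group_closed (isotropy hs n).
Proof.
split=> [|u v /isotropyP[->|[Gu fu]] /isotropyP[->|[Gv fv]]]; apply/isotropyP.
- by left.
- by left; rewrite invg1 mulg1.
- right; split=> //; rewrite mul1g; exact: group_closedV Gamma_closed _ Gv.
- by right; rewrite invg1 mulg1.
by right; split=> //; exact: Gamma_closed.2.
Qed.

HB.instance Definition _ n :=
  isMulClosed.Build (PGL2 k) (isotropy hs n)
    (group_closedM (isotropy_closed n)).
HB.instance Definition _ n :=
  isMul1Closed.Build (PGL2 k) (isotropy hs n) (isotropy_closed n).1.
HB.instance Definition _ n :=
  isInvClosed.Build (PGL2 k) (isotropy hs n)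
    (group_closedV (isotropy_closed n)).

End Action.

(* The element (a, b, c, d) of calN, for t = (a, b, c) and d in k. *)
Definition param (k : fieldType) (char2 : 2%N \in [pchar k])
    (t : nz_triple k) (d : k) : calN char2 := (t, \pi_(kmodAS char2) d).

(* Main.v *)
Require Import Defs.
From HB Require Import structures.
From mathcomp Require Import all_boot all_order all_algebra qfpoly.
From mathcomp Require Import zify ring.
From mathcomp Require Import boolp classical_sets.

(** A k-isomorphism between two of these curves is an isomorphism of function
    fields, so it exhibits a field L = k(x)(y) = k(X)(Y) with two Artin-Schreier
    models, y^2 + y = q(x) / h(x) + d and similarly for X and Y, where
    h = x^3 + s x + s.  If X is not in k(x), let A T^2 + B T + C be its primitive
    polynomial over k[x].  As x has degree at most 2 over k(X), Gauss's lemma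
    bounds the degrees of A, B, C in x by 2; but A C / B^2 differs from q / h + d
    by some v^2 + v, and the simple pole at h can only be cleared by h | B, which
    is absurd.  Hence k(X) = k(x), and Gauss's
    lemma again shows X to be a Moebius transform of x.  Moreover Y = y + v, and
    comparing poles makes v constant and shows that the transformation preserves
    h up to a scalar.  Over k[x] / h the cubic h splits with roots the images of x
    under Gamma, so the transformation is in Gamma.  Automorphisms lifting an
    element of order 3 can be corrected to have order 3 since the kernel has
    order 2. *)

Set Implicit Arguments.
Unset Strict Implicit.
Unset Printing Implicit Defensive.

Import GRing.Theory.
Local Open Scope ring_scope.

(** * Gauss's lemma over k[x] *)

Section Gauss.
Variable k : fieldType.
Implicit Types (p q pi : {poly k}) (F G H : {poly {poly k}}).
Local Notation kx := {fraction {poly k}}.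
Local Notation frac := (@tofrac {poly k}).

Lemma irredp_factor p : p != 0 -> size p != 1%N ->
  exists2 pi, irreducible_poly pi & pi %| p.
Proof.
have [n] := ubnP (size p); elim: n p => // n IH p szp p0 p1.
have [irr_p|] := pselect (irreducible_poly p); first by exists p.
rewrite /irreducible_poly => nirr.
have [q [q1 dvd nE]] : exists q, [/\ size q != 1%N, q %| p & ~~ (q %= p)].
  apply: contra_notP nirr => nex; split.
    by case: (size p) p1 (size_poly_eq0 p) => [|[|?]] //; rewrite (negPf p0).
  by move=> q q1 qp; apply/negPn/negP => nE; apply: nex; exists q.
have q0 : q != 0 by apply: contraTneq dvd => ->; rewrite dvd0p.
have lt_qp : (size q < size p)%N.
  by rewrite ltn_neqAle dvdp_leq // andbT dvdp_size_eqp.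
have [pi irr_pi pi_q] := IH q (leq_trans lt_qp szp) q0 q1.
by exists pi => //; apply: dvdp_trans dvd.
Qed.

Lemma irredp_dvdM pi p q :
  irreducible_poly pi -> pi %| p * q -> ~~ (pi %| p) -> pi %| q.
Proof.
move=> irr dvd ndvd; rewrite -(Gauss_dvdpr q (_ : coprimep pi p)) //.
apply/negPn/negP => ncop; case/negP: ndvd.
have E := irr.2 _ ncop (dvdp_gcdl _ _).
by rewrite -(eqp_dvdl _ E) dvdp_gcdr.
Qed.

(** Trivial content, tested on irreducible divisors, so that no gcd of the coefficients has to be
    formed; the zero polynomial is excluded. *)
Definition primitive F :=
  forall pi, irreducible_poly pi -> exists i, ~~ (pi %| F`_i).

(** Gauss's lemma modulo [pi]: if [i] is the first index with [F_i] not divisible by [pi], then the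
    coefficient of index [i + j] in the product is congruent to [F_i H_j], once the earlier [H_l]
    are known to be divisible by [pi]. *)
Lemma primitive_coefM pi F H : irreducible_poly pi -> primitive F ->
  (forall i, pi %| (F * H)`_i) -> forall j, pi %| H`_j.
Proof.
move=> irr prF dvd.
have [i ndvd mini] := ex_minnP (prF _ irr).
elim/ltn_ind=> j IH; apply: (irredp_dvdM irr _ ndvd).
have lt_i : (i < (i + j).+1)%N by rewrite ltnS leq_addr.
have := dvd (i + j)%N; rewrite coefM (bigD1 (Ordinal lt_i)) //= addKn.
rewrite dvdp_addl //; apply: (big_ind (fun p => pi %| p)) => [||l].
- exact: dvdp0.
- by move=> p q pp qp; rewrite dvdp_add.
rewrite -val_eqE /= neq_ltn => /orP[lt_l|lt_l].
  apply: dvdp_mulr; apply/negPn/negP=> /mini.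
  by rewrite leqNgt lt_l.
by apply: dvdp_mull; apply: IH; have := ltn_ord l; lia.
Qed.

(** The irreducible factors of [p] are cancelled one at a time: each divides all coefficients of
    [F * H], hence all those of [H]. *)
Lemma primitive_dvd F G H p : primitive F -> p != 0 -> p *: G = F * H ->
  exists H', G = F * H'.
Proof.
move=> prF; have [n] := ubnP (size p).
elim: n p H => // n IH p H szp p0 E.
have [/size_poly1P[c c0 pc]|sz1] := boolP (size p == 1%N).
  exists (c^-1%:P *: H); rewrite -scalerAr -E scalerA pc -polyCM mulVf //.
  by rewrite scale1r.
have [pi irr /dvdpP[q pE]] := irredp_factor p0 sz1.
have pi0 := irredp_neq0 irr.
have H_dvd : forall j, pi %| H`_j.
  apply: (primitive_coefM irr prF) => i.
  by rewrite -E coefZ pE mulrAC dvdp_mull.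
pose H' := map_poly (fun c => c %/ pi) H.
have HE : H = pi *: H'.
  by apply/polyP=> i; rewrite coefZ coef_map_id0 ?div0p // mulrC divpK.
have q0 : q != 0 by apply: contra_neq p0; rewrite pE => ->; rewrite mul0r.
apply: (IH q H') => //.
  have := szp; rewrite pE size_mul //.
  move: irr.1; rewrite -size_poly_gt0 in q0; move: q0.
  by case: (size pi) (size q) => [|[|m]] [|l] //=; lia.
have pi0' : pi%:P != 0 by rewrite polyC_eq0.
apply: (mulfI pi0'); rewrite !mul_polyC scalerA [pi * q]mulrC -pE E HE.
by rewrite -scalerAr.
Qed.

Lemma clear_denominators (Q : {poly kx}) :
  exists2 p, p != 0 & exists H, frac p *: Q = map_poly frac H.
Proof.
elim/poly_ind: Q => [|Q c [p p0 [H E]]].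
  by exists 1; rewrite ?oner_eq0 //; exists 0; rewrite scaler0 rmorph0.
have [u [v [v0 Ec]]] := fracP c.
exists (p * v); first by rewrite mulf_neq0.
exists (v *: H * 'X + (p * u)%:P).
rewrite rmorphD /= map_polyC /=.
have -> : map_poly frac (v *: H * 'X) = frac v *: (frac p *: Q) * 'X.
  by rewrite rmorphM /= map_polyZ map_polyX E.
rewrite scalerDr scalerA -tofracM [v * p]mulrC scalerAl; congr (_ + _).
by rewrite -mul_polyC -polyCM !tofracM -mulrA [_ * c]mulrC Ec.
Qed.

(** After denominators are cleared, common irreducible factors of the coefficients are divided out;
    this stops because the degree of the leading coefficient drops each time. *)
Lemma primitive_form (Q : {poly kx}) : Q != 0 ->
  exists2 r : kx, r != 0 &
    exists2 F, primitive F & r *: Q = map_poly frac F.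
Proof.
move=> Q0; have [p p0 [H E]] := clear_denominators Q.
have {E} : exists2 r : kx, r != 0 & r *: Q = map_poly frac H.
  by exists (frac p); rewrite ?tofrac_eq0.
have [n] := ubnP (size (lead_coef H)).
elim: n H => // n IH H szH [r r0 E].
have [prH|] := pselect (primitive H); first by exists r => //; exists H.
move/existsNP=> [pi /not_implyP[irr ndvd]].
have H_dvd i : pi %| H`_i.
  by apply/negPn/negP=> nd; apply: ndvd; exists i.
have pi0 := irredp_neq0 irr.
pose H' := map_poly (fun c => c %/ pi) H.
have HE : H = pi *: H'.
  by apply/polyP=> i; rewrite coefZ coef_map_id0 ?div0p // mulrC divpK.
have H0 : H != 0.
  apply: contra_neq Q0 => H0; move: E; rewrite H0 rmorph0.
  by move/eqP; rewrite scaler_eq0 (negPf r0) => /eqP.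
apply: (IH H').
  move: szH; rewrite HE -mul_polyC lead_coefM lead_coefC.
  have l0 : lead_coef H' != 0.
    by rewrite lead_coef_eq0; apply: contra_neq H0; rewrite HE => ->; rewrite scaler0.
  rewrite size_mul //; move: irr.1; rewrite -size_poly_gt0 in l0; move: l0.
  by case: (size pi) (size (lead_coef H')) => [|[|m]] [|l] //=; lia.
have pi0' : tofrac pi != 0 by rewrite tofrac_eq0.
have i0 : (frac pi)^-1 != 0 by rewrite invr_eq0.
exists ((frac pi)^-1 * r); first exact: mulf_neq0 i0 r0.
by rewrite -scalerA E HE map_polyZ scalerA (mulVf pi0') scale1r.
Qed.

(** Primitivity of [F] moves the quotient from k(x)[T] into k[x][T], where the degree in x, measured
    by [sizeY], is additive. *)
Lemma primitive_sizeY F G (Q : {poly kx}) : primitive F -> G != 0 ->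
  map_poly frac G = map_poly frac F * Q -> (sizeY F <= sizeY G)%N.
Proof.
move=> prF G0 E.
have [p p0 [H EH]] := clear_denominators Q.
have [H' GE] : exists H', G = F * H'.
  apply: (@primitive_dvd F G H p) => //.
  apply: (map_inj_poly (f := @tofrac {poly k})) => [x y /eqP||].
  - by rewrite tofrac_eq => /eqP.
  - exact: tofrac0.
  by rewrite map_polyZ rmorphM /= -EH E scalerAr.
have [F0 H0] : F != 0 /\ H' != 0.
  by apply/andP; rewrite -negb_or -mulf_eq0 -GE.
rewrite !sizeYE GE rmorphM /= size_mul ?swapXY_eq0 //.
by rewrite -ltnS prednK ?addn_gt0 ?size_poly_gt0 ?swapXY_eq0 ?F0 //
  -addn1 leq_add2l size_poly_gt0 swapXY_eq0.
Qed.

End Gauss.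

(** * Two rational subfields of one field *)

Section TwoGenerators.
Variables k L : fieldType.
Local Notation kx := {fraction {poly k}}.
Local Notation frac := (@tofrac {poly k}).
Implicit Types (g h : {rmorphism kx -> L}) (y z : L).

Definition spans g y := forall z, exists c0 c1, z = g c0 + g c1 * y.

Lemma horner_frac g p :
  g (frac p) = (map_poly (g \o (frac \o polyC)) p).[g (frac 'X)].
Proof. exact: (esym (horner_rmorph (g \o frac) p)). Qed.

Lemma horner_map2 (U : {poly {poly L}}) a b :
  U.[a%:P].[b] = (map_poly (horner_eval b) U).[a].
Proof.
by have := horner_map (horner_eval b) U a%:P; rewrite /= /horner_eval hornerC.
Qed.

(** A polynomial relation over k between the images of ['X] under [g] and [h] can be ordered by
    powers of either one, provided that the two embeddings agree on constants. *)
Lemma horner_swapXY_frac g h P : (forall c, g (frac c%:P) = h (frac c%:P)) ->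
  (map_poly (g \o frac) (swapXY P)).[h (frac 'X)] =
  (map_poly (h \o frac) P).[g (frac 'X)].
Proof.
move=> gh; pose c : {rmorphism k -> L} := g \o (frac \o polyC).
have E1 (Q : {poly {poly k}}) : map_poly (g \o frac) Q =
    map_poly (horner_eval (g (frac 'X))) (map_poly (map_poly c) Q).
  by rewrite -map_poly_comp; apply: eq_map_poly => p; apply: horner_frac.
have E2 (Q : {poly {poly k}}) : map_poly (h \o frac) Q =
    map_poly (horner_eval (h (frac 'X))) (map_poly (map_poly c) Q).
  rewrite -map_poly_comp; apply: eq_map_poly => p /=; rewrite horner_frac.
  by rewrite /horner_eval; congr (_.[_]); apply: eq_map_poly => a; rewrite /= gh.
by rewrite E1 E2 -!horner_map2 -swapXY_map horner2_swapXY.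
Qed.

(* With X = h 'X and x = g 'X: the primitive polynomial of X over k[x] has
   degree less than m in x as soon as x is a root of a nonzero polynomial of
   degree less than m over k[X]. *)
Lemma minpoly_coef_size g h m (P : {poly {poly k}}) (Q : {poly kx}) :
  (forall c, g (frac c%:P) = h (frac c%:P)) ->
  P != 0 -> (map_poly (h \o frac) P).[g (frac 'X)] = 0 -> (size P <= m)%N ->
  Q != 0 -> (map_poly g Q).[h (frac 'X)] = 0 ->
  (forall R : {poly kx}, (size R < size Q)%N ->
     (map_poly g R).[h (frac 'X)] = 0 -> R = 0) ->
  exists2 r : kx, r != 0 &
    exists2 F : {poly {poly k}}, (forall i, (size (F`_i)%R <= m)%N) &
      r *: Q = map_poly frac F.
Proof.
move=> gh P0 PX szP Q0 QX minQ.
have [r r0 [F prF E]] := primitive_form Q0.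
exists r => //; exists F => // i.
apply: leq_trans (max_size_coefXY _ _) _.
(* The relation [P] for x over k[X] is reordered as a relation for X over k[x]; the minimal [Q]
   divides it over k(x). *)
pose G := swapXY P.
have G0 : G != 0 by rewrite swapXY_eq0.
apply: leq_trans (_ : sizeY G <= m)%N; last by rewrite sizeYE swapXYK.
pose Gk := map_poly frac G.
have GX : (map_poly g Gk).[h (frac 'X)] = 0.
  by rewrite -map_poly_comp horner_swapXY_frac.
have dvd : Q %| Gk.
  apply/eqP/minQ; first by rewrite ltn_modp.
  have := congr1 (fun p => (map_poly g p).[h (frac 'X)]) (divp_eq Gk Q).
  by rewrite GX rmorphD rmorphM !hornerE QX mulr0 add0r => <-.
have [S ES] := dvdpP _ _ dvd.
apply: (@primitive_sizeY _ F G (r^-1 *: S)) prF G0 _.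
by rewrite -E -scalerAr -scalerAl scalerA mulVf // scale1r mulrC.
Qed.

End TwoGenerators.

(** * The rational subfield generated by x is unique *)

Section HyperellipticSubfield.
Variables (k : fieldType) (char2 : 2%N \in [pchar k]).
Variables (s : k) (irr : irreducible_poly (cubic s)).
Local Notation kx := {fraction {poly k}}.
Local Notation frac := (@tofrac {poly k}).
Local Notation h := (cubic s).

Lemma rmorph_two (L : nzRingType) (e : {rmorphism k -> L}) : 2%:R = 0 :> L.
Proof. by rewrite -(rmorph_nat e) (pcharf0 char2) rmorph0. Qed.

Lemma frac_two : 2%:R = 0 :> kx.
Proof. exact: (rmorph_two (frac \o polyC)). Qed.

Lemma rhs_eq (t : nz_triple k) (d : k) :
  rhs s t d * frac h = frac (quad t + d *: h).
Proof.
have h0 : frac h != 0 by rewrite tofrac_eq0 irredp_neq0.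
by rewrite /rhs mulrDl divfK // -mul_polyC [in RHS]rmorphD [in RHS]rmorphM.
Qed.

Lemma h_ndvd_quad (t : nz_triple k) : ~~ (h %| quad t).
Proof.
by apply/negP=> /(dvdp_leq (quad_neq0 t)); rewrite size_cubic leqNgt ltnS size_quad.
Qed.

Lemma h_sqr_dvd p : h %| p ^+ 2 -> h %| p.
Proof. by rewrite expr2; apply: irr_sqr. Qed.

(* The pole of rhs at the cubic place is simple, hence survives the addition of
   v ^ 2 + v and forces the trace B / A to vanish there. *)
Lemma cubic_dvd_trace (t : nz_triple k) (d : k) (c0 c1 r : kx) (A B C : {poly k}) :
  c1 != 0 -> r = frac A -> r * c1 = frac B ->
  r * (c0 ^+ 2 + c0 * c1 + c1 ^+ 2 * rhs s t d) = frac C -> h %| B.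
Proof.
move=> c10 rA rB rC.
(* With c0 / c1 = m / n in lowest terms, [E] says that A C / B^2 = (m / n)^2 + m / n + rhs. *)
have [m [n [n0 cop vE]]] := frac_coprime (c0 / c1).
have E : B ^+ 2 * ((m ^+ 2 + m * n) * h + n ^+ 2 * (quad t + d *: h)) =
    A * C * n ^+ 2 * h.
  move: (rhs_eq t d) rC; move: h (quad t + d *: h) (rhs s t d) => p q f qE rC.
  apply/eqP; rewrite -tofrac_eq !(tofracM, tofracD, tofracXn) -qE -rC -rB -rA -vE.
  have c0E : c0 = c0 / c1 * c1 by rewrite divfK.
  apply/eqP; rewrite [in RHS]c0E.
  by move: (c0 / c1) (frac p) (frac n) => v a b; ring.
apply: contraT => hB.
(* If h does not divide [B], then [E] modulo h gives h | n, since h does not divide [quad t]; after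
   one factor h is cancelled, it gives h | m, against coprimality. *)
have hn : h %| n.
  have : h %| B ^+ 2 * (n ^+ 2 * quad t).
    have -> : B ^+ 2 * (n ^+ 2 * quad t) = h * (A * C * n ^+ 2 -
        B ^+ 2 * (m ^+ 2 + m * n + n ^+ 2 * d%:P)).
      rewrite mulrBr [h * (A * _ * _)]mulrC -E -mul_polyC; ring.
    exact: dvdp_mulr.
  move/(irredp_dvdM irr)=> /(_ (contra (@h_sqr_dvd _) hB)).
  rewrite mulrC => /(irredp_dvdM irr)=> /(_ (h_ndvd_quad t)).
  exact: h_sqr_dvd.
have hm : ~~ (h %| m).
  apply/negP=> hm; have /coprimepP/(_ _ hm hn)/eqp_size := cop.
  by rewrite size_cubic size_poly1.
have h0 : h != 0 by rewrite irredp_neq0.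
have /dvdpP[n' nE] := hn.
have : h %| B ^+ 2 * m ^+ 2.
  have -> : B ^+ 2 * m ^+ 2 = h * (A * C * n' ^+ 2 * h -
      B ^+ 2 * (m * n' + n' ^+ 2 * quad t + n' ^+ 2 * d%:P * h)).
    apply: (mulIf h0); rewrite mulrBr mulrBl.
    have -> : h * (A * C * n' ^+ 2 * h) * h = A * C * n ^+ 2 * h.
      rewrite nE; ring.
    rewrite -E nE -mul_polyC; ring.
  exact: dvdp_mulr.
by move/(irredp_dvdM irr)=> /(_ (contra (@h_sqr_dvd _) hB))/h_sqr_dvd; rewrite (negPf hm).
Qed.

Section Models.
Variable L : fieldType.
Implicit Types (g : {rmorphism kx -> L}) (y z : L) (t : nz_triple k) (d : k).

Definition is_model g y t d : Prop :=
  spans g y /\ y ^+ 2 + y = g (rhs s t d).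

Lemma gtwo g : 2%:R = 0 :> L.
Proof. exact: (rmorph_two (g \o (frac \o polyC))). Qed.

Lemma model_irrational g y t d : is_model g y t d -> forall r, y <> g r.
Proof.
move=> [_ yE] r yr; case/negP: (model_root irr t d r).
rewrite /root /model !(hornerE, hornerXn) subr_eq0 -(inj_eq (fmorph_inj g)).
by rewrite rmorphD rmorphXn -yr yE.
Qed.

Lemma model_free g y t d a b : is_model g y t d ->
  g a + g b * y = 0 -> a = 0 /\ b = 0.
Proof.
move=> mod1 E; have b0 : b = 0.
  have [//|bn] := eqVneq b 0; have gn : g b != 0 by rewrite fmorph_eq0.
  case: (model_irrational mod1 (r := - a / b)).
  apply: (mulfI gn); rewrite fmorph_div rmorphN [RHS]mulrC (divfK gn).
  by apply/eqP; rewrite eq_sym -subr_eq0 -opprD oppr_eq0 E.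
by move: E; rewrite b0 rmorph0 mul0r addr0 => /eqP; rewrite fmorph_eq0 => /eqP.
Qed.

(** The coefficients are the trace and the norm of c0 + c1 y, whose conjugate is c0 + c1 (y + 1). *)
Lemma model_quadratic g y t d z : is_model g y t d ->
  exists c0 c1, z = g c0 + g c1 * y /\
    z ^+ 2 + g c1 * z + g (c0 ^+ 2 + c0 * c1 + c1 ^+ 2 * rhs s t d) = 0.
Proof.
case=> sp yE; have [c0 [c1 zE]] := sp z; exists c0, c1; split=> //.
have two := gtwo g; move: (rhs s t d) yE => f yE.
rewrite !(rmorphD, rmorphM, rmorphXn) /= -yE zE; ring: two.
Qed.

Lemma relation_over g y t d z : is_model g y t d ->
  exists P : {poly {poly k}},
    [/\ P != 0, (size P <= 3)%N & (map_poly (g \o frac) P).[z] = 0].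
Proof.
move/(model_quadratic z)=> [c0 [c1 [_]]]; move: (_ + _ : kx) => N E.
have [u0 [v0 [v0n E0]]] := fracP c1; have [u1 [v1 [v1n E1]]] := fracP N.
exists (Poly [:: u1 * v0; u0 * v1; v0 * v1]).
have PE : Poly [:: u1 * v0; u0 * v1; v0 * v1] = [:: u1 * v0; u0 * v1; v0 * v1] :> seq _.
  by apply: (@PolyK _ 0); rewrite /= mulf_neq0.
split.
- by rewrite -size_poly_eq0 PE.
- by rewrite PE.
rewrite horner_coef size_map_inj_poly ?rmorph0 //; last first.
  by move=> a b /fmorph_inj/eqP; rewrite tofrac_eq => /eqP.
rewrite PE !big_ord_recl big_ord0 /= !coef_map PE /= !rmorphM /= -E0 -E1 !rmorphM /=.
have := congr1 (fun z => g (frac v0) * g (frac v1) * z) E; rewrite mulr0 addr0 => <-.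
rewrite /bump /= add1n expr1; ring.
Qed.

(** If the trace [c1] of X is nonzero, then [Q] is the minimal polynomial of X over k(x). Its
    primitive multiple has coefficients of degree at most 2 in x, yet the middle one is nonzero and
    divisible by the cubic. *)
Lemma x_rational g (h1 : {rmorphism kx -> L}) y z t d t' d' :
  (forall c, g (frac c%:P) = h1 (frac c%:P)) ->
  is_model g y t d -> is_model h1 z t' d' -> exists u, h1 (frac 'X) = g u.
Proof.
move=> gh mod1 mod2.
have [P [P0 szP PX]] := relation_over (g (frac 'X)) mod2.
have [c0 [c1 [XE rel]]] := model_quadratic (h1 (frac 'X)) mod1.
have [c10|c1n] := eqVneq c1 0; first by exists c0; rewrite XE c10 rmorph0 mul0r addr0.
case: notF; move: rel; set N := (X in _ + g X = 0) => rel.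
pose Q : {poly kx} := Poly [:: N; c1; 1].
have QE : Q = [:: N; c1; 1] :> seq _ by apply: (@PolyK _ 0); rewrite /= oner_eq0.
have QX : (map_poly g Q).[h1 (frac 'X)] = 0.
  rewrite horner_coef size_map_poly QE !big_ord_recl big_ord0 /= !coef_map QE /=.
  rewrite rmorph1 addr0 /bump /= add1n expr1 -[RHS]rel; ring.
have Q0 : Q != 0 by rewrite -size_poly_eq0 QE.
have minQ (R : {poly kx}) : (size R < size Q)%N ->
    (map_poly g R).[h1 (frac 'X)] = 0 -> R = 0.
  rewrite QE => szR; rewrite (@horner_coef_wide _ 2); last by rewrite size_map_poly.
  rewrite !big_ord_recl big_ord0 /= !coef_map /= /bump /= add1n expr1 mulr1 addr0 XE => E.
  have {}E : g (R`_0 + R`_1 * c0) + g (R`_1 * c1) * y = 0.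
    rewrite -{}E !rmorphD !rmorphM /=; ring.
  have [R0 /eqP] := model_free mod1 E; rewrite mulf_eq0 (negPf c1n) orbF => /eqP R1.
  move: R0; rewrite R1 mul0r addr0 => R0.
  apply/polyP=> [[|[|i]]]; rewrite coef0 //.
  by apply: nth_default; exact: leq_trans (szR : (size R <= 2)%N) _.
have [r r0 [F szF E]] := minpoly_coef_size gh P0 PX szP Q0 QX minQ.
have FE i : r * Q`_i = frac F`_i by rewrite -coefZ E coef_map.
have hB : h %| F`_1.
  apply: (@cubic_dvd_trace t d c0 c1 r F`_2 F`_1 F`_0 c1n).
  - by rewrite -FE QE mulr1.
  - by rewrite -FE QE.
  - by rewrite -FE QE.
have : F`_1 != 0 by rewrite -tofrac_eq0 -FE QE; exact: mulf_neq0 r0 c1n.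
by move/dvdp_leq=> /(_ _ hB); rewrite size_cubic leqNgt ltnS szF.
Qed.

End Models.
End HyperellipticSubfield.

(** * Poles and the stabilizer of the cubic *)

(** The nested predecessors are what [size_mul] yields for a product of three polynomials whose
    middle factor is the cubic, of size 4. *)
Lemma size_cofactor_leq (a b : nat) :
  (0 < a -> ((a + 4).-1 + b).-1 <= 4 -> b <= 1)%N.
Proof. lia. Qed.

Section CharacteristicTwo.
Variables (R : nzRingType) (char2 : 2%N \in [pchar R]).

Lemma eq_pchar2 (x y : R) : x + y = 0 -> x = y.
Proof. by move/eqP; rewrite addr_eq0 (oppr_pchar2 char2) => /eqP. Qed.

Lemma even_pchar2 n : ~~ odd n -> n%:R = 0 :> R.
Proof.
by move=> ev; rewrite -(odd_double_half n) (negPf ev) -addnn add0n natrD (addrr_pchar2 char2).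
Qed.

End CharacteristicTwo.

(* The integer coefficients of an identity that only holds in characteristic two
   are reduced by supplying the vanishing of all even numerals that occur. *)
Ltac char2_ring c :=
  apply: (eq_pchar2 c);
  ring: (even_pchar2 c (n := 32) isT) (even_pchar2 c (n := 26) isT)
    (even_pchar2 c (n := 24) isT) (even_pchar2 c (n := 22) isT)
    (even_pchar2 c (n := 20) isT) (even_pchar2 c (n := 18) isT)
    (even_pchar2 c (n := 16) isT) (even_pchar2 c (n := 14) isT)
    (even_pchar2 c (n := 12) isT) (even_pchar2 c (n := 10) isT)
    (even_pchar2 c (n := 8) isT) (even_pchar2 c (n := 6) isT)
    (even_pchar2 c (n := 4) isT) (even_pchar2 c (n := 2) isT).

Section Substitution.
Variables (k : fieldType) (char2 : 2%N \in [pchar k]).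
Variables (s : k) (irr : irreducible_poly (cubic s)).
Local Notation kx := {fraction {poly k}}.
Local Notation frac := (@tofrac {poly k}).
Local Notation h := (cubic s).
Implicit Types (p q : {poly k}) (t : nz_triple k) (d e : k).

(** The homogenized cubic q^3 h(p / q), which pulls h back along p / q without leaving k[x]. *)
Definition cubic_form p q := p ^+ 3 + s%:P * p * q ^+ 2 + s%:P * q ^+ 3.

(** The homogenized quadratic numerator. It takes an arbitrary row, so that it also applies to the
    image of a row under a block of [M w]. *)
Definition row_form (r : 'rV[k]_3) p q :=
  (r 0 0)%:P * p ^+ 2 + (r 0 1)%:P * p * q + (r 0 2)%:P * q ^+ 2.

Lemma poly_char2 : 2%N \in [pchar {poly k}].
Proof. by rewrite inE /= (rmorph_two char2 polyC) eqxx. Qed.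

Lemma cubicE : h = 'X^3 + s%:P * 'X + s%:P.
Proof. by rewrite /cubic -mul_polyC. Qed.

Lemma quadE t : quad t = row_form (val t) 'X 1.
Proof. by rewrite /quad /row_form -!mul_polyC; ring. Qed.

Lemma size_mul_leq p q m n :
  (size p <= m.+1)%N -> (size q <= n.+1)%N -> (size (p * q)%R <= (m + n).+1)%N.
Proof. by move=> sp sq; apply: leq_trans (size_polyMleq _ _) _; lia. Qed.

Lemma size_add_leq p q n :
  (size p <= n)%N -> (size q <= n)%N -> (size (p + q)%R <= n)%N.
Proof. by move=> sp sq; apply: leq_trans (size_polyD _ _) _; rewrite geq_max sp. Qed.

Lemma size_cubic_form p q : (size p <= 2)%N -> (size q <= 2)%N ->
  (size (cubic_form p q) <= 4)%N.
Proof.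
move=> sp sq; have sC := size_polyC_leq1 s.
have sM (a b c : {poly k}) : (size a <= 2)%N -> (size b <= 2)%N -> (size c <= 2)%N ->
    (size (a * (b * c))%R <= 4)%N.
  by move=> sa sb sc; exact: size_mul_leq sa (size_mul_leq sb sc).
rewrite /cubic_form -mulrA !exprS expr0 !mulr1; apply: size_add_leq.
  apply: size_add_leq; first exact: sM.
  by apply: (@size_mul_leq _ _ 0 3) => //; exact: sM.
by apply: (@size_mul_leq _ _ 0 3) => //; exact: sM.
Qed.

Lemma size_row_form r p q : (size p <= 2)%N -> (size q <= 2)%N ->
  (size (row_form r p q * q)%R <= 4)%N.
Proof.
move=> sp sq; apply: (@size_mul_leq _ _ 2 1) => //.
have sM a (b c : {poly k}) : (size b <= 2)%N -> (size c <= 2)%N ->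
    (size (a%:P * (b * c))%R <= 3)%N.
  move=> sb sc; apply: (@size_mul_leq _ _ 0 2); first exact: size_polyC_leq1.
  exact: size_mul_leq sb sc.
by rewrite /row_form -mulrA !expr2; do !apply: size_add_leq; exact: sM.
Qed.

(** The coefficient of degree three isolates [d], because h is a monic cubic and the row form has
    degree at most two there. *)
Lemma row_formD_inj (r r' : 'rV[k]_3) d d' :
  row_form r 'X 1 + d%:P * h = row_form r' 'X 1 + d'%:P * h -> r = r' /\ d = d'.
Proof.
move=> E; have co i := congr1 (fun p : {poly k} => p`_i) E.
have dd : d = d'.
  have := co 3; rewrite cubicE /row_form !(expr1n, mulr1) !coefE /=.
  by rewrite !(mulr0, mulr1, addr0, add0r).
split=> //; move: E; rewrite dd => /addIr E'.
have {}co i := congr1 (fun p : {poly k} => p`_i) E'.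
apply/rowP=> i; move: (co 2) (co 1) (co 0).
rewrite /row_form !(expr1n, mulr1) !coefE /= !(mulr0, mulr1, addr0, add0r) => E2 E1 E0.
by case: i => [[|[|[|//]]] lti]; [rewrite -[LHS]/(r 0 _) | |];
  [move: E2 | move: E1 | move: E0]; congr (_ = _); congr (_ _ _); apply: val_inj.
Qed.

(** Modulo h, the form splits up to a factor into three linear forms in [p] and [q], one for each
    element of Gamma. The prime h divides one of them, and a polynomial of degree at most 2
    divisible by h is zero. *)
Lemma cubic_form_cases (w : k) p q : s = 1 + w + w ^+ 2 ->
  (size p <= 2)%N -> (size q <= 2)%N -> h %| cubic_form p q ->
  [\/ p = 'X * q, p * ('X + w%:P + 1) = (w%:P * 'X + s%:P) * q
    | p * ('X + w%:P) = ((1 + w%:P) * 'X + s%:P) * q].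
Proof.
move=> hs szp szq dvd.
have /(irredp_dvdM irr) : h %| (p - 'X * q) *
   ((p * ('X + w%:P + 1) - (w%:P * 'X + s%:P) * q) *
    (p * ('X + w%:P) - ((1 + w%:P) * 'X + s%:P) * q)).
  (* Comparing the coefficients of p^3 gives the multiplier of [cubic_form p q]; the rest is a
     multiple of h. *)
  have -> : (p - 'X * q) *
     ((p * ('X + w%:P + 1) - (w%:P * 'X + s%:P) * q) *
      (p * ('X + w%:P) - ((1 + w%:P) * 'X + s%:P) * q)) =
    ('X + w%:P + 1) * ('X + w%:P) * cubic_form p q +
    (p ^+ 2 * q + p * q ^+ 2 + (w%:P + w%:P ^+ 2) * q ^+ 3) * h.
    rewrite !(oppr_pchar2 poly_char2) cubicE /cubic_form hs.
    rewrite !(polyCD, polyC_exp) polyC1; char2_ring poly_char2.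
  by rewrite dvdp_add ?dvdp_mull.
have small (r : {poly k}) : (size r <= 3)%N -> h %| r -> r = 0.
  move=> szr hr; apply/eqP/negPn/negP => r0.
  by have := dvdp_leq r0 hr; rewrite size_cubic leqNgt ltnS szr.
have szl (a b : k) : (size (a%:P * 'X + b%:P)%R <= 2)%N.
  by rewrite size_MXaddC; case: ifP => // _; rewrite ltnS size_polyC leq_b1.
have sz2 (p1 q1 p2 q2 : {poly k}) : (size p1 <= 2)%N -> (size q1 <= 2)%N ->
    (size p2 <= 2)%N -> (size q2 <= 2)%N -> (size (p1 * q1 - p2 * q2)%R <= 3)%N.
  by move=> *; apply: size_add_leq; rewrite ?size_polyN; exact: (@size_mul_leq _ _ 1 1).
move=> H.
have [h1|h1] := boolP (h %| p - 'X * q).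
  apply: Or31; apply/eqP; rewrite -subr_eq0; apply/eqP/small => //.
  by rewrite -[p]mulr1; apply: sz2; rewrite ?size_polyX ?size_poly1.
have [h2|h2] := boolP (h %| p * ('X + w%:P + 1) - (w%:P * 'X + s%:P) * q).
  apply: Or32; apply/eqP; rewrite -subr_eq0; apply/eqP/small => //.
  apply: sz2 => //.
  by rewrite -addrA -polyC1 -polyCD size_XaddC.
have h3 := irredp_dvdM irr (H h1) h2.
apply: Or33; apply/eqP; rewrite -subr_eq0; apply/eqP/small => //.
apply: sz2 => //; first by rewrite size_XaddC.
by rewrite -polyC1 -polyCD; apply: szl.
Qed.

(** For nonconstant [m] the square dominates, and the sum is nonconstant as well. *)
Lemma artin_schreier_const (m : {poly k}) :
  (size (m ^+ 2 + m)%R <= 1)%N -> exists e, m = e%:P.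
Proof.
have [/size1_polyC mE _|sz] := leqP (size m) 1; first by exists m`_0.
have m0 : m != 0 by rewrite -size_poly_gt0; exact: ltnW.
have szM : (size (m ^+ 2)%R = size m + (size m).-1)%N.
  by rewrite expr2 size_mul //; move: sz; case: (size m) => // a _; rewrite addSn addnS.
have lt_m : (size m < size (m ^+ 2)%R)%N.
  by rewrite szM -addn1 leq_add2l; move: sz; case: (size m) => [|[|]].
rewrite size_polyDl // leqNgt (leq_trans sz) //; exact: ltnW.
Qed.

(* Comparing poles: the image of the cubic place has to be the cubic place. *)
Lemma rhs_subst t t' d d' (v : kx) p q :
  (size p <= 2)%N -> (size q <= 2)%N -> cubic_form p q != 0 ->
  (rhs s t d + v ^+ 2 + v) * frac (cubic_form p q) =
    frac (row_form (val t') p q * q + d'%:P * cubic_form p q) ->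
  h %| cubic_form p q /\ exists e, v = frac e%:P.
Proof.
move=> szp szq hg0 E.
have [m [n [n0 cop vE]]] := frac_coprime v.
have {}E : ((quad t + d *: h) * n ^+ 2 + (m ^+ 2 + m * n) * h) * cubic_form p q =
    (row_form (val t') p q * q + d'%:P * cubic_form p q) * (n ^+ 2 * h).
  move: (row_form _ _ _ * _ + _) E => r.
  move: (rhs_eq irr t d); move: (cubic_form p q) h (quad t + d *: h) (rhs s t d).
  move=> c1 h1 q1 f qE E.
  apply/eqP; rewrite -tofrac_eq !(tofracM, tofracD, tofracXn) -E -qE -vE.
  by apply/eqP; move: (frac c1) (frac h1) (frac n) => a b c; ring.
have h0 : h != 0 by rewrite irredp_neq0.
(* Otherwise the simple pole of [rhs] at h would have to be cancelled by v^2 + v, whose poles have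
   even order: first h | n, then h | m. *)
have hh : h %| cubic_form p q.
  move: (cubic_form p q) (row_form _ _ _ * _ + _) hg0 E => c1 r c10 E.
  apply: contraT => hc.
  have : h %| quad t * (n ^+ 2 * c1).
    have -> : quad t * (n ^+ 2 * c1) = h * (r * n ^+ 2 -
        (d%:P * n ^+ 2 + m ^+ 2 + m * n) * c1).
      rewrite mulrBr; have -> : h * (r * n ^+ 2) = r * (n ^+ 2 * h) by ring.
      rewrite -E -mul_polyC; ring.
    exact: dvdp_mulr.
  move/(irredp_dvdM irr)=> /(_ (h_ndvd_quad s t)).
  rewrite mulrC => /(irredp_dvdM irr)=> /(_ hc)/(h_sqr_dvd irr) hn.
  have hm : ~~ (h %| m).
    apply/negP=> hm; have /coprimepP/(_ _ hm hn)/eqp_size := cop.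
    by rewrite size_cubic size_poly1.
  have /dvdpP[n' nE] := hn.
  have : h %| c1 * m ^+ 2.
    have -> : c1 * m ^+ 2 = h * (r * n' ^+ 2 * h -
        (quad t * n' ^+ 2 + d%:P * n' ^+ 2 * h + m * n') * c1).
      apply: (mulIf h0); rewrite mulrBr mulrBl.
      have -> : h * (r * n' ^+ 2 * h) * h = r * (n ^+ 2 * h) by rewrite nE; ring.
      rewrite -E nE -mul_polyC; ring.
    exact: dvdp_mulr.
  by move/(irredp_dvdM irr)=> /(_ hc)/(h_sqr_dvd irr); rewrite (negPf hm).
split=> //; have /dvdpP[l lE] := hh.
have l0 : l != 0 by apply: contra_neq hg0; rewrite lE => ->; rewrite mul0r.
have /size1_polyC lC : (size l <= 1)%N.
  have := size_cubic_form szp szq; rewrite lE size_mul // size_cubic.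
  by rewrite addnS (leq_add2r 3 _ 1).
pose r := row_form (val t') p q * q + d'%:P * cubic_form p q.
have szr : (size r <= 4)%N.
  apply: size_add_leq; first exact: size_row_form.
  apply: (@size_mul_leq _ _ 0 3); first exact: size_polyC_leq1.
  exact: size_cubic_form.
have {}E : l * h * (m ^+ 2 + m * n) = n ^+ 2 * (r - l * (quad t + d *: h)).
  apply: (mulIf h0); rewrite mulrBr mulrBl.
  have -> : n ^+ 2 * r * h = r * (n ^+ 2 * h) by rewrite mulrAC mulrC.
  rewrite -E lE; move: (quad t + d *: h) h => a b; ring.
(* Here n^2 is coprime to l (m^2 + m n), so it divides h. By irreducibility [n] is then a unit or an
   associate of h, and degrees exclude the latter. *)
have n1 : size n = 1%N.
  apply/eqP/negPn/negP => n1.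
  have cop2 : coprimep (n ^+ 2) (l * (m ^+ 2 + m * n)).
    have c0 : l`_0 != 0 by apply: contra_neq l0 => c0; rewrite lC c0 polyC0.
    rewrite lC mul_polyC coprimepZr // addrC coprimep_expl //.
    by rewrite coprimep_addl_mul coprimep_expr // coprimep_sym.
  have : n ^+ 2 %| h.
    by rewrite -(Gauss_dvdpl _ cop2) mulrCA mulrA E dvdp_mulIl.
  move=> n2h; have nE : n %= h.
    by apply: irr.2 n1 _; apply: dvdp_trans n2h; rewrite expr2 dvdp_mulIl.
  have := dvdp_leq h0 n2h; rewrite expr2 size_mul // (eqp_size nE) size_cubic.
  by [].
have [nu nu0 nE] := size_poly1P _ (introT eqP n1).
(* Now [v] is the polynomial m / nu, and l h (v^2 + v) has degree at most 3, which makes v^2 + v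
   constant. *)
have [e eE] : exists e, nu^-1 *: m = e%:P.
  apply: artin_schreier_const.
  have lh0 : l * h != 0 by rewrite mulf_neq0.
  have nu2 : nu ^+ 2 != 0 by rewrite expf_neq0.
  pose m' := nu^-1 *: m.
  have mE : m = nu *: m' by rewrite /m' scalerA divff // scale1r.
  have EE : l * h * (m' ^+ 2 + m') = r - l * (quad t + d *: h).
    apply: (scalerI nu2); move: E; rewrite mE nE -!mul_polyC.
    move: (r - _) => R E; rewrite polyC_exp -E; ring.
  have [->|m'0] := eqVneq (m' ^+ 2 + m') 0; first by rewrite size_poly0.
  have sz : (size (l * h * (m' ^+ 2 + m'))%R <= 4)%N.
    rewrite EE; apply: size_add_leq => //; rewrite size_polyN.
    apply: (@size_mul_leq _ _ 0 3); first by rewrite lC size_polyC_leq1.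
    apply: size_add_leq; first by apply: leq_trans (size_quad t) _.
    by apply: leq_trans (size_scale_leq _ _) _; rewrite size_cubic.
  apply: (size_cofactor_leq (a := size l)); first by rewrite size_poly_gt0.
  by move: sz; rewrite size_mul // size_mul // size_cubic.
exists e; rewrite -eE.
have fn0 : frac n != 0 by rewrite tofrac_eq0.
apply: (mulIf fn0); rewrite vE -tofracM nE mulrC -mul_polyC mulrA -polyCM.
by rewrite divff // mul1r.
Qed.

End Substitution.

(** * Comparison of two models of the same field *)

Section Comparison.
Variables (k : fieldType) (char2 : 2%N \in [pchar k]).
Variables (s w : k) (irr : irreducible_poly (cubic s)) (hs : s = 1 + w + w ^+ 2).
Local Notation kx := {fraction {poly k}}.
Local Notation frac := (@tofrac {poly k}).
Local Notation h := (cubic s).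
Implicit Types (p q : {poly k}) (t : nz_triple k) (d e : k).

(** Numerators and denominators of the elements of Gamma are scaled so that the homogenized cubic
    takes the value h exactly, not just up to a constant. *)
Definition Gamma_num (i : 'I_3) : {poly k} :=
  nth 0 [:: 'X; w%:P * 'X + s%:P; (1 + w%:P) * 'X + s%:P] i.
Definition Gamma_den (i : 'I_3) : {poly k} :=
  nth 0 [:: 1; 'X + w%:P + 1; 'X + w%:P] i.

Lemma cubic_form_Gamma i : cubic_form s (Gamma_num i) (Gamma_den i) = h.
Proof.
have c2 := poly_char2 char2.
case: i => [[|[|[|//]]] lti]; rewrite /cubic_form /Gamma_num /Gamma_den /= cubicE.
- by ring.
- by rewrite hs !(polyCD, polyC_exp) polyC1; char2_ring c2.
by rewrite hs !(polyCD, polyC_exp) polyC1; char2_ring c2.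
Qed.

Lemma Gamma_den_neq0 i : Gamma_den i != 0.
Proof.
case: i => [[|[|[|//]]] lti]; rewrite /Gamma_den /= ?oner_eq0 //.
  by rewrite -addrA -polyC1 -polyCD -size_poly_eq0 size_XaddC.
by rewrite -size_poly_eq0 size_XaddC.
Qed.

Section Field.
Variable L : fieldType.
Variables g h1 : {rmorphism kx -> L}.
Hypothesis gh : forall c, g (frac c%:P) = h1 (frac c%:P).
Local Notation X := (h1 (frac 'X)).

Lemma cubic_form_image p q : X * g (frac q) = g (frac p) ->
  h1 (frac h) * g (frac q) ^+ 3 = g (frac (cubic_form s p q)).
Proof.
move=> Xpq; rewrite cubicE /cubic_form !(tofracM, tofracD, tofracXn).
rewrite !(rmorphM, rmorphD, rmorphXn) /= -gh -Xpq; ring.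
Qed.

(** The fraction in [rhs] has a numerator of degree at most two over a cubic denominator, whence the
    extra factor [q] after homogenizing. *)
Lemma rhs_form t' d' p q : X * g (frac q) = g (frac p) ->
  h1 (rhs s t' d') * g (frac (cubic_form s p q)) =
  g (frac (row_form (val t') p q * q + d'%:P * cubic_form s p q)).
Proof.
move=> Xpq.
have hE := cubic_form_image Xpq.
have E : h1 (rhs s t' d') * h1 (frac h) =
    h1 (frac (quad t')) + h1 (frac d'%:P) * h1 (frac h).
  rewrite -rmorphM (rhs_eq irr) -mul_polyC; move: (quad t') h => a b.
  by rewrite tofracD tofracM rmorphD rmorphM.
rewrite -hE mulrA E mulrDl -mulrA hE.
have gD a b : g (frac (a + d'%:P * b)) = g (frac a) + h1 (frac d'%:P) * g (frac b).
  by rewrite tofracD tofracM rmorphD rmorphM -gh.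
rewrite gD; congr (_ + _); rewrite quadE /row_form !(expr1n, mulr1).
rewrite !(tofracM, tofracD, tofracXn) !(rmorphM, rmorphD, rmorphXn) /= -!gh -Xpq.
ring.
Qed.

(** Since x is rational in X, it satisfies a linear relation over k[X]; hence the primitive
    polynomial of X over k[x], itself linear, has coefficients of degree at most one in x. *)
Lemma moebius_of_model y z t d t' d' :
  is_model s g y t d -> is_model s h1 z t' d' ->
  exists p q, [/\ (size p <= 2)%N, (size q <= 2)%N, q != 0
    & X * g (frac q) = g (frac p)].
Proof.
move=> mod1 mod2.
have [u uE] := x_rational char2 irr gh mod1 mod2.
have [r rE] := x_rational char2 irr (fun c => esym (gh c)) mod2 mod1.
have [r1 [r2 [r20 Er]]] := fracP r.
have PE : Poly [:: - r1; r2] = [:: - r1; r2] :> seq _ by apply: (@PolyK _ 0).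
pose P := Poly [:: - r1; r2].
have P0 : P != 0 by rewrite -size_poly_eq0 PE.
have PX : (map_poly (h1 \o frac) P).[g (frac 'X)] = 0.
  rewrite (@horner_coef_wide _ 2); last first.
    by apply: leq_trans (size_poly _ _) _; rewrite PE.
  rewrite !big_ord_recl big_ord0 /= !coef_map PE /= rE mulr1 addr0.
  by rewrite tofracN rmorphN -Er rmorphM expr1 mulrC addNr.
have Q0 : 'X - u%:P != 0 by rewrite polyXsubC_eq0.
have QX : (map_poly g ('X - u%:P)).[X] = 0.
  by rewrite rmorphB /= map_polyX map_polyC !hornerE uE subrr.
have minQ (R : {poly kx}) : (size R < size ('X - u%:P)%R)%N ->
    (map_poly g R).[X] = 0 -> R = 0.
  rewrite size_XsubC ltnS => /size1_polyC ->; rewrite map_polyC hornerC => /eqP.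
  by rewrite fmorph_eq0 => /eqP->.
have szP : (size P <= 2)%N by rewrite PE.
have [r0 r00 [F szF E]] := minpoly_coef_size gh P0 PX szP Q0 QX minQ.
have FE i : r0 * ('X - u%:P)`_i = frac F`_i by rewrite -coefZ E coef_map.
have F1 : r0 = frac F`_1.
  by rewrite -FE coefB coefX coefC /= subr0 mulr1.
have F0 : r0 * u = frac (- F`_0).
  by rewrite tofracN -FE coefB coefX coefC /= sub0r mulrN opprK.
exists (- F`_0), F`_1; split=> //; first by rewrite size_polyN.
  by rewrite -tofrac_eq0 -F1.
by rewrite uE -F1 -F0 rmorphM mulrC.
Qed.

Lemma cubic_form_neq0 p q : q != 0 -> X * g (frac q) = g (frac p) ->
  cubic_form s p q != 0.
Proof.
move=> q0 Xpq.
have hE := cubic_form_image Xpq.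
rewrite -tofrac_eq0 -(fmorph_eq0 g) -hE mulf_eq0 negb_or.
rewrite expf_neq0 ?fmorph_eq0 ?tofrac_eq0 // andbT; exact: irredp_neq0.
Qed.

(** Write z = v0 + v1 y. As z^2 + z lies in k(x), the coefficient v1^2 + v1 of y vanishes. The case
    v1 = 0 would put z in k(x), and with it y, which is a combination of 1 and z over k(X). *)
Lemma y_translate y z t d t' d' : is_model s g y t d -> is_model s h1 z t' d' ->
  exists v, z = y + g v.
Proof.
move=> mod1 mod2; have [u uE] := x_rational char2 irr gh mod1 mod2.
have L2 : 2%N \in [pchar L] by rewrite inE /= (gtwo char2 g) eqxx.
have h1g_poly a : exists r, h1 (frac a) = g r.
  exists (map_poly (frac \o polyC) a).[u].
  rewrite -horner_map horner_frac uE /= -map_poly_comp.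
  by congr (_.[_]); apply: eq_map_poly => c; rewrite /= gh.
have h1g r : exists r', h1 r = g r'.
  have [a [b [b0 E]]] := fracP r; have [a' aE] := h1g_poly a.
  have [b' bE] := h1g_poly b; exists (a' / b').
  have b0' : h1 (frac b) != 0 by rewrite fmorph_eq0 tofrac_eq0.
  by apply: (mulIf b0'); rewrite -rmorphM E fmorph_div -aE -bE divfK.
have [v0 [v1 zE]] := mod1.1 z; have [f' fE] := h1g (rhs s t' d').
have zg : forall r, z <> g r.
  move=> r zr; have [a [b yE]] := mod2.1 y.
  have [a' aE] := h1g a; have [b' bE] := h1g b.
  have {}yE : y = g (a' + b' * r) by rewrite rmorphD rmorphM -aE -bE -zr.
  exact: (model_irrational irr mod1) yE.
have rel : g (v0 ^+ 2 + v1 ^+ 2 * rhs s t d + v0 - f') + g (v1 * (v1 + 1)) * y = 0.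
  have := mod2.2; have := mod1.2; rewrite fE; move: (rhs s t d) => f E1 E2.
  rewrite !(rmorphD, rmorphXn, rmorphM, rmorphN, rmorph1) /= -E1 -E2 zE.
  by rewrite (oppr_pchar2 L2); char2_ring L2.
have [_ /eqP] := model_free irr mod1 rel; rewrite mulf_eq0 => /orP[] /eqP v1E.
  by case: (zg v0); rewrite zE v1E rmorph0 mul0r addr0.
exists v0; rewrite zE addrC; congr (_ + _).
have kx2 : 2%N \in [pchar kx] by rewrite inE /= (frac_two char2) eqxx.
by rewrite (eq_pchar2 kx2 v1E) rmorph1 mul1r.
Qed.

(** The relation is stated for the scaled representative of the transformation rather than for the
    [p] and [q] found first, so that both sides have the denominator h. *)
Lemma model_compare y z t d t' d' :
  is_model s g y t d -> is_model s h1 z t' d' ->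
  exists i, exists e, [/\ X * g (frac (Gamma_den i)) = g (frac (Gamma_num i)),
    z = y + g (frac e%:P) &
    quad t + (d + (e ^+ 2 + e))%:P * h =
    row_form (val t') (Gamma_num i) (Gamma_den i) * Gamma_den i + d'%:P * h].
Proof.
move=> mod1 mod2.
have [p [q [szp szq q0 Xpq]]] := moebius_of_model mod1 mod2.
have [v zE] := y_translate mod1 mod2.
have L2 : 2%N \in [pchar L] by rewrite inE /= (gtwo char2 g) eqxx.
have rhsE : h1 (rhs s t' d') = g (rhs s t d + v ^+ 2 + v).
  rewrite -mod2.2 zE; have := mod1.2; move: (rhs s t d) => f E.
  rewrite !(rmorphD, rmorphXn) /= -E; char2_ring L2.
have subst p' q' : X * g (frac q') = g (frac p') ->
    (rhs s t d + v ^+ 2 + v) * frac (cubic_form s p' q') =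
    frac (row_form (val t') p' q' * q' + d'%:P * cubic_form s p' q').
  by move/(rhs_form t' d'); rewrite rhsE -rmorphM => /fmorph_inj.
have [hpq [e vE]] := rhs_subst char2 irr szp szq (cubic_form_neq0 q0 Xpq) (subst _ _ Xpq).
have [i Xi] : exists i, X * g (frac (Gamma_den i)) = g (frac (Gamma_num i)).
  have key p' q' : p * q' = p' * q -> X * g (frac q') = g (frac p').
    move=> E; have gq : g (frac q) != 0 by rewrite fmorph_eq0 tofrac_eq0.
    apply: (mulIf gq); by rewrite mulrAC Xpq -rmorphM -tofracM E tofracM rmorphM.
  have [E1|E1|E1] := cubic_form_cases char2 irr hs szp szq hpq.
  - by exists (Ordinal (isT : (0 < 3)%N)); apply: key; rewrite /= mulr1.
  - by exists (Ordinal (isT : (1 < 3)%N)); apply: key.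
  by exists (Ordinal (isT : (2 < 3)%N)); apply: key.
exists i, e; split=> //; first by rewrite zE vE.
move: (subst _ _ Xi); rewrite cubic_form_Gamma vE.
have -> : (rhs s t d + frac e%:P ^+ 2 + frac e%:P) * frac h =
   frac (quad t + (d + (e ^+ 2 + e))%:P * h).
  move: (rhs_eq irr t d); rewrite -mul_polyC !polyCD polyC_exp.
  move: (quad t) h (rhs s t d) (d%:P) (e%:P) => a b f d1 e1 E.
  have -> : a + (d1 + (e1 ^+ 2 + e1)) * b = a + d1 * b + (e1 * e1 + e1) * b by ring.
  by rewrite tofracD -E !(tofracD, tofracM) expr2; ring.
by move/eqP; rewrite tofrac_eq => /eqP.
Qed.

End Field.
End Comparison.

(** * The action on parameters *)

Section Action.
Local Open Scope quotient_scope.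
Variables (k : fieldType) (char2 : 2%N \in [pchar k]).
Variables (s : k).
Local Notation h := (cubic s).
Implicit Types (t : nz_triple k) (d e : k).

(** This is where the entries of [M w] come from: the substituted numerator is divided by h, the
    remainder giving the first three coordinates and the constant quotient the change of the
    fourth. *)
Lemma row_form_M (w : k) (r : 'rV[k]_3) : s = 1 + w + w ^+ 2 ->
  row_form r (w%:P * 'X + s%:P) ('X + w%:P + 1) * ('X + w%:P + 1) =
  row_form (r *m ulsubmx (M w)) 'X 1 + ((r *m ursubmx (M w)) 0 0)%:P * h.
Proof.
move=> hs; have c2 := poly_char2 char2.
rewrite /row_form cubicE !mxE !big_ord_recl !big_ord0 !mxE /= !addr0.
have -> : r 0 (lift ord0 ord0) = r 0 1 by congr (r _ _); apply: val_inj.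
have -> : r 0 (lift ord0 (lift ord0 ord0)) = r 0 2 by congr (r _ _); apply: val_inj.
have -> : r 0 ord0 = r 0 0 by [].
move: (r 0 0) (r 0 1) (r 0 2) => a b c.
rewrite hs !(polyCD, polyCM, polyC_exp) polyC1 ?polyC0.
char2_ring c2.
Qed.


Lemma pi_AS d d' :
  \pi_(kmodAS char2) d = \pi_(kmodAS char2) d' <-> exists e, d + (e ^+ 2 + e) = d'.
Proof.
have E : (\pi_(kmodAS char2) d == \pi_(kmodAS char2) d') = (d - d' \in AS char2).
  exact/esym/Quotient.idealrBE.
split=> [/eqP|[e eE]].
  rewrite E => /asboolP[e eE]; exists e; rewrite addrC [e ^+ 2 + e]addrC -eE.
  by rewrite (oppr_pchar2 char2) addrAC (addrr_pchar2 char2) add0r.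
apply/eqP; rewrite E; apply/asboolP; exists e.
by rewrite -eE opprD addrA subrr add0r (oppr_pchar2 char2) addrC.
Qed.

(** Here [w] is quantified, so that [w + 1], which satisfies the same equation for [s], can be used
    for [gamma2]. *)
Lemma param_actM (w : k) t t' d d' : s = 1 + w + w ^+ 2 ->
  (exists e, quad t + (d + (e ^+ 2 + e))%:P * h =
     row_form (val t') (w%:P * 'X + s%:P) ('X + w%:P + 1) * ('X + w%:P + 1) +
     d'%:P * h) <->
  param char2 t d = actM w (param char2 t' d').
Proof.
move=> hs; rewrite row_form_M //; set l := (X in X%:P * h).
have actE2 : (actM w (param char2 t' d')).2 = \pi_(kmodAS char2) (l + d').
  by rewrite actM2 /= -raddfD.
have rowE : row_form (val t' *m ulsubmx (M w)) 'X 1 + l%:P * h + d'%:P * h =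
    row_form (val t' *m ulsubmx (M w)) 'X 1 + (l + d')%:P * h.
  by rewrite polyCD mulrDl addrA.
rewrite rowE quadE; split=> [[e /row_formD_inj[tE dE]]|E].
  apply: injective_projections; first by apply: val_inj; rewrite actM1.
  by rewrite actE2; apply/pi_AS; exists e.
have /pi_AS[e dE] : \pi_(kmodAS char2) d = \pi_(kmodAS char2) (l + d').
  by rewrite -actE2 -E.
have := actM1 w (param char2 t' d'); rewrite -E /= => tE.
by exists e; rewrite dE tE.
Qed.

Variables (w : k) (hs : s = 1 + w + w ^+ 2).

Definition Gamma_elt (i : 'I_3) : PGL2 k :=
  nth 1%g [:: 1%g; gamma1 s w; gamma2 s w] i.

Lemma GammaE g : g \in Gamma s w <-> exists i, g = Gamma_elt i.
Proof.
split=> [/GammaP[]->|[[[|[|[|//]]] lti] ->]].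
- by exists (Ordinal (isT : (0 < 3)%N)).
- by exists (Ordinal (isT : (1 < 3)%N)).
- by exists (Ordinal (isT : (2 < 3)%N)).
- exact/GammaP/Or31.
- exact/GammaP/Or32.
exact/GammaP/Or33.
Qed.

Lemma param_act i t t' d d' :
  (exists e, quad t + (d + (e ^+ 2 + e))%:P * h =
     row_form (val t') (Gamma_num s w i) (Gamma_den w i) * Gamma_den w i +
     d'%:P * h) <->
  param char2 t d = act s w (param char2 t' d') (Gamma_elt i).
Proof.
case: i => [[|[|[|//]]] lti]; rewrite /Gamma_num /Gamma_den /Gamma_elt /=.
- rewrite act1 mulr1 !quadE; split=> [[e /row_formD_inj[tE dE]]|E].
    apply: injective_projections; first exact: val_inj.
    by apply/pi_AS; exists e.
  have /pi_AS[e <-] : \pi_(kmodAS char2) d = \pi_(kmodAS char2) d'.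
    exact: (congr1 snd E).
  by have tE : t = t' := congr1 fst E; exists e; rewrite tE.
- by rewrite (actg1 hs); apply: param_actM.
rewrite (actg2 hs) -param_actM; last first.
  by rewrite hs; char2_ring char2.
rewrite polyCD polyC1 [w%:P + 1]addrC.
have -> : 'X + (1 + w%:P) + 1 = 'X + w%:P by char2_ring (poly_char2 char2).
by [].
Qed.

End Action.

(** * Construction of isomorphisms *)

Lemma bundle_rmorphism (R S : pzRingType) (f : R -> S) :
  zmod_morphism f -> monoid_morphism f -> exists F : {rmorphism R -> S}, F =1 f.
Proof.
move=> fB fM.
pose F : {rmorphism R -> S} := HB.pack f (GRing.isZmodMorphism.Build R S f fB)
  (GRing.isMonoidMorphism.Build R S f fM).
by exists F.
Qed.

(** The universal property of the fraction field: all representations u / v of a fraction give the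
    same value, which is selected by choice. *)
Lemma lift_frac (k L : fieldType) (phi : {rmorphism {poly k} -> L}) :
  injective phi ->
  exists g : {rmorphism {fraction {poly k}} -> L}, forall p, g (tofrac p) = phi p.
Proof.
move=> inj_phi; have phi0 p : p != 0 -> phi p != 0.
  by apply: contra_neq => p0; apply: inj_phi; rewrite p0 rmorph0.
have /choice[f fE] (r : {fraction {poly k}}) : exists z, forall u v, v != 0 ->
    r * tofrac v = tofrac u -> z = phi u / phi v.
  have [u0 [v0 [v00 E0]]] := fracP r; exists (phi u0 / phi v0) => u v v_0 E.
  apply/eqP; rewrite eqr_div ?phi0 // -!rmorphM; apply/eqP; congr (phi _).
  apply/eqP; rewrite -tofrac_eq !tofracM -E0 -E; apply/eqP.
  by move: (tofrac v) (tofrac v0) => a b; ring.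
have f_frac p : f (tofrac p) = phi p.
  by rewrite (fE _ p 1) ?oner_eq0 ?tofrac1 ?mulr1 // rmorph1 divr1.
have [||g gE] := @bundle_rmorphism _ _ f.
- move=> r r'; have [u [v [v0 E]]] := fracP r; have [u' [v' [v0' E']]] := fracP r'.
  rewrite (fE _ _ _ v0 E) (fE _ _ _ v0' E').
  rewrite (fE _ (u * v' - u' * v) (v * v')); last first.
  - rewrite tofracB !tofracM -E -E'.
    by move: (tofrac v) (tofrac v') => a b; ring.
  - by rewrite mulf_neq0.
  rewrite rmorphB !rmorphM; field; by rewrite !phi0.
- split=> [|r r']; first by rewrite -tofrac1 f_frac rmorph1.
  have [u [v [v0 E]]] := fracP r; have [u' [v' [v0' E']]] := fracP r'.
  rewrite (fE _ _ _ v0 E) (fE _ _ _ v0' E').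
  rewrite (fE _ (u * u') (v * v')); last first.
  - rewrite !tofracM -E -E'.
    by move: (tofrac v) (tofrac v') => a b; ring.
  - by rewrite mulf_neq0.
  by rewrite !rmorphM mulf_div.
by exists g => p; rewrite gE.
Qed.

(** Evaluation at a root of [h] is unaffected by reduction modulo [h], so it descends to the
    quotient. *)
Lemma lift_qfpoly (F L : fieldType) (h : {poly F}) (hI : monic_irreducible_poly h)
    (g : {rmorphism F -> L}) (y : L) : root (map_poly g h) y ->
  exists f : {rmorphism {poly %/ h with hI} -> L},
    (forall c, f (qf_const hI c) = g c) /\ f ('qX : {poly %/ h}) = y.
Proof.
move=> hy; have hm : h \is monic := hI.2.
pose v (z : {poly %/ h with hI}) : {poly F} := val (z : {poly %/ h}).
pose f z := (map_poly g (v z)).[y].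
have in_qE p : f (in_qpoly h p) = (map_poly g p).[y].
  rewrite /f /v /= (mk_monicE hI) [p in RHS](Pdiv.RingMonic.rdivp_eq hm).
  by rewrite rmorphD rmorphM !hornerE (eqP hy) mulr0 add0r.
have [||G GE] := @bundle_rmorphism _ _ f.
- move=> a b; rewrite /f (_ : v (a - b) = v a - v b) //.
  by rewrite rmorphB hornerD hornerN.
- split=> [|a b]; first by rewrite /f (_ : v 1 = 1%:P) // map_polyC hornerC; exact: rmorph1.
  have -> : a * b = in_qpoly h (v a * v b).
    by apply: val_inj.
  by rewrite in_qE rmorphM hornerM.
exists G; split=> [c|]; first by rewrite GE /f /= map_polyC hornerC.
by rewrite GE (in_qE 'X) map_polyX hornerX.
Qed.

Section CurveIsomorphisms.
Variable k : fieldType.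
Implicit Types (C D : curve k).

Lemma local_ring_preim C D (f : {rmorphism ffield D -> ffield C})
    (O : set (ffield C)) : (forall c, f (fconst D c) = fconst C c) ->
  (forall z, exists z', f z' = z) -> is_local_ring O ->
  is_local_ring (fun z => O (f z)).
Proof.
move=> fc fsurj [Oc OB OM OV [z nz]]; split=> [c|z1 z2|z1 z2|z1|].
- by rewrite fc.
- by rewrite rmorphB; apply: OB.
- by rewrite rmorphM; apply: OM.
- by rewrite fmorphV.
by have [z' z'E] := fsurj z; exists z'; rewrite z'E.
Qed.

Lemma point_eq C (P Q : Defs.point C) : (forall z, sval P z <-> sval Q z) -> P = Q.
Proof.
case: P Q => [P hP] [Q hQ] /= PQ.
have PQE : P = Q by apply: funext => z; apply: propext.
by move: hP; rewrite PQE => hP; rewrite (Prop_irrelevance hP hQ).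
Qed.

(** Closed points are valuation rings of the function field, so the map on points is preimage under
    [f], with preimage under the inverse of [f] as its inverse. *)
Lemma curve_iso_of_rmorphism C D (f : {rmorphism ffield D -> ffield C}) :
  (forall c, f (fconst D c) = fconst C c) -> (forall z, exists z', f z' = z) ->
  exists phi : curve_iso C D, pullback phi =1 f.
Proof.
move=> fc fsurj; have [f' f'E] := choice fsurj.
have fK : cancel f f' by move=> z; apply: (fmorph_inj f); rewrite f'E.
have [||F FE] := @bundle_rmorphism _ _ f'.
- by move=> a b; apply: (fmorph_inj f); rewrite rmorphB !f'E.
- split=> [|a b]; apply: (fmorph_inj f); first by rewrite f'E rmorph1.
  by rewrite rmorphM !f'E.
have Fc c : F (fconst C c) = fconst D c by rewrite FE -fc fK.
have Fsurj z : exists z', F z' = z by exists (f z); rewrite FE fK.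
pose on (P : Defs.point C) : Defs.point D := exist _ _ (local_ring_preim fc fsurj (svalP P)).
pose no (P : Defs.point D) : Defs.point C := exist _ _ (local_ring_preim Fc Fsurj (svalP P)).
have H : is_curve_iso on f.
  split.
  - exists no => P; apply: point_eq => z /=; first by rewrite FE f'E.
    by rewrite FE fK.
  - by exists f'.
  - exact: rmorphB.
  - by split; [exact: rmorph1 | exact: rmorphM].
  - exact: fc.
  - by [].
by exists (CurveIso H).
Qed.

Lemma pullback_rmorphism C D (phi : curve_iso C D) :
  exists f : {rmorphism ffield D -> ffield C}, f =1 pullback phi.
Proof.
by apply: bundle_rmorphism; [exact: ci_add (curve_isoP phi)
                            | exact: ci_mul (curve_isoP phi)].
Qed.

End CurveIsomorphisms.

Lemma rhs_image (k L : fieldType) (g : {rmorphism {fraction {poly k}} -> L})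
    (s : k) (t : nz_triple k) (d : k)
    (e := fun c => g (tofrac c%:P)) (x := g (tofrac 'X)) :
  g (rhs s t d) = (e (val t 0 0) * x ^+ 2 + e (val t 0 1) * x + e (val t 0 2)) /
    (x ^+ 3 + e s * x + e s) + e d.
Proof.
rewrite /e /x /rhs /quad /cubic -!mul_polyC.
by rewrite !(tofracM, tofracD, tofracXn) !(rmorphD, rmorphM, fmorphV, rmorphXn).
Qed.

Section ModelCurves.
Variables (k : fieldType) (s : k) (irr : irreducible_poly (cubic s)).
Implicit Types (t : nz_triple k) (d : k).
Local Notation frac := (@tofrac {poly k}).
Local Notation K t d := (ffield (model_curve irr t d)).

Definition model_frac t d : {rmorphism {fraction {poly k}} -> K t d} :=
  qf_const (model_irreducible irr t d).

Lemma model_curve_is_model t d :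
  is_model s (model_frac t d) (model_y irr t d) t d.
Proof.
split=> [z|]; first by apply: qfpoly_quadratic; rewrite size_model.
by rewrite model_equation rhs_image.
Qed.

Lemma model_frac_poly t d p : model_frac t d (frac p) =
  (map_poly (fconst (model_curve irr t d)) p).[model_x irr t d].
Proof. exact: (horner_frac (model_frac t d) p). Qed.

Lemma model_x_transcendental t d :
  ~ algebraicOver (fconst (model_curve irr t d)) (model_x irr t d).
Proof.
case=> p p0; rewrite /root -model_frac_poly fmorph_eq0 tofrac_eq0.
exact/negP.
Qed.

End ModelCurves.

Lemma algebraic_horner (k L : fieldType) (e : {rmorphism k -> L}) (p : {poly k}) x :
  algebraicOver e x -> algebraicOver e (map_poly e p).[x].
Proof.
move=> alg_x; elim/poly_ind: p => [|p c IH].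
  by rewrite rmorph0 horner0; apply: algebraic0.
rewrite rmorphD rmorphM /= map_polyX map_polyC !hornerE.
by apply: algebraic_add; [exact: algebraic_mul | exact: algebraic_id].
Qed.

Lemma artin_schreier_shift (L : fieldType) (L2 : 2%N \in [pchar L]) (y a r : L) :
  y ^+ 2 + y = r -> (y + a) ^+ 2 + (y + a) = r + (a ^+ 2 + a).
Proof. by move=> <-; char2_ring L2. Qed.

Lemma root_model (k L : fieldType) (g : {rmorphism {fraction {poly k}} -> L})
    (s : k) (t : nz_triple k) (d : k) (y : L) :
  y ^+ 2 + y = g (rhs s t d) -> root (map_poly g (model s t d)) y.
Proof.
rewrite /root /model; move: (rhs s t d) => f.
rewrite rmorphB rmorphD /= map_polyXn map_polyX map_polyC.
by rewrite !(hornerE, hornerXn) subr_eq0 => ->.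
Qed.

Section MoebiusInverse.
Variables (L : fieldType) (L2 : 2%N \in [pchar L]) (a b x X : L).
Hypothesis hb : b = 1 + a + a ^+ 2.

(** The transformation has determinant a (a + 1) + b = 1, which amounts to (X + a) (x + a + 1) = 1
    and shows that X + a is nonzero. *)
Lemma moebius_inverse1 : x + a + 1 != 0 -> X * (x + a + 1) = a * x + b ->
  X + a != 0 /\ x = ((1 + a) * X + b) / (X + a).
Proof.
move=> D0 XE; have E : (X + a) * (x + a + 1) = 1.
  by rewrite mulrDl XE hb; char2_ring L2.
have X0 : X + a != 0.
  by apply: contra_eq_neq E => ->; rewrite mul0r eq_sym oner_eq0.
split=> //; apply: (mulIf X0); rewrite divfK //; apply: (mulIf D0).
rewrite -mulrA E mulrDl -mulrA XE hb; char2_ring L2.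
Qed.

Lemma moebius_inverse2 : x + a != 0 -> X * (x + a) = (1 + a) * x + b ->
  X + a + 1 != 0 /\ x = (a * X + b) / (X + a + 1).
Proof.
move=> D0 XE; have E : (X + a + 1) * (x + a) = 1.
  by rewrite -addrA mulrDl XE hb; char2_ring L2.
have X0 : X + a + 1 != 0.
  by apply: contra_eq_neq E => ->; rewrite mul0r eq_sym oner_eq0.
split=> //; apply: (mulIf X0); rewrite divfK //; apply: (mulIf D0).
rewrite -mulrA E mulrDl -mulrA XE hb; char2_ring L2.
Qed.

End MoebiusInverse.

Section Existence.
Variables (k : fieldType) (char2 : 2%N \in [pchar k]).
Variables (s w : k) (irr : irreducible_poly (cubic s)) (hs : s = 1 + w + w ^+ 2).
Implicit Types (t : nz_triple k) (d e : k).
Local Notation kx := {fraction {poly k}}.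
Local Notation frac := (@tofrac {poly k}).
Local Notation h := (cubic s).
Local Notation num := (Gamma_num s w).
Local Notation den := (Gamma_den w).
Local Notation K t d := (ffield (model_curve irr t d)).

Lemma moebius_inverse (L : fieldType) (c : {rmorphism k -> L}) (i : 'I_3) (x X : L) :
  (map_poly c (den i)).[x] != 0 ->
  X * (map_poly c (den i)).[x] = (map_poly c (num i)).[x] ->
  exists j, (map_poly c (den j)).[X] != 0 /\
    x = (map_poly c (num j)).[X] / (map_poly c (den j)).[X].
Proof.
have L2 : 2%N \in [pchar L] by rewrite inE /= (rmorph_two char2 c) eqxx.
have hsL : c s = 1 + c w + c w ^+ 2 by rewrite hs !rmorphD rmorph1 rmorphXn.
have mapE := (rmorphD, rmorphM, rmorph1).
case: i => [[|[|[|//]]] lti]; rewrite /Gamma_num /Gamma_den /=.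
- rewrite rmorph1 map_polyX !hornerE => _ ->.
  exists (Ordinal (isT : (0 < 3)%N)); rewrite /= rmorph1 map_polyX !hornerE.
  by rewrite divr1 oner_eq0.
- rewrite !mapE /= !map_polyC map_polyX !hornerE => D0 XE.
  exists (Ordinal (isT : (2 < 3)%N)).
  rewrite /= !mapE /= !map_polyC map_polyX !hornerE.
  by have := moebius_inverse1 L2 hsL D0 XE.
rewrite !mapE /= !map_polyC map_polyX !hornerE => D0 XE.
exists (Ordinal (isT : (1 < 3)%N)).
rewrite /= !mapE /= !map_polyC map_polyX !hornerE.
by have := moebius_inverse2 L2 hsL D0 XE.
Qed.

(** The map x -> X, y -> Y is built in two stages: k(x) embeds because X is transcendental, and the
    embedding extends because Y is a root of the image of the model, by [rel]. *)
Lemma model_iso_exists (i : 'I_3) e t t' d d' :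
  quad t' + (d' + (e ^+ 2 + e))%:P * h =
    row_form (val t) (num i) (den i) * den i + d%:P * h ->
  exists f : curve_iso (model_curve irr t' d') (model_curve irr t d),
    pullback f (model_x irr t d) * model_frac irr t' d' (frac (den i)) =
      model_frac irr t' d' (frac (num i)) /\
    pullback f (model_y irr t d) =
      model_y irr t' d' + fconst (model_curve irr t' d') e.
Proof.
move=> rel; set C' := model_curve irr t' d'; set C := model_curve irr t d.
set g' := model_frac irr t' d'; set x' := model_x irr t' d'.
pose c := fconst C'; have g'E p : g' (frac p) = (map_poly c p).[x'].
  exact: model_frac_poly.
have D0 : g' (frac (den i)) != 0 by rewrite fmorph_eq0 tofrac_eq0 Gamma_den_neq0.
pose X := g' (frac (num i)) / g' (frac (den i)).
have XE : X * g' (frac (den i)) = g' (frac (num i)) by rewrite divfK.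
have [j [Dj0 x'E]] : exists j, (map_poly c (den j)).[X] != 0 /\
    x' = (map_poly c (num j)).[X] / (map_poly c (den j)).[X].
  by apply: (@moebius_inverse _ c i); rewrite -!g'E.
(* By the inverse transformation x' is rational in X, so X is transcendental along with x'. *)
have X_tr : ~ algebraicOver c X.
  move=> algX; apply: (@model_x_transcendental _ _ irr t' d'); rewrite -/x' x'E.
  by apply: algebraic_div; apply: algebraic_horner.
pose phi : {rmorphism {poly k} -> ffield C'} := horner_eval X \o map_poly c.
have phi_inj : injective phi.
  apply: raddf_inj => p phip0; apply/eqP/negPn/negP => p0; apply: X_tr.
  by exists p => //; apply/eqP.
have [g gE] := lift_frac phi_inj.
have gc a : g' (frac a%:P) = g (frac a%:P).
  by rewrite gE /= /horner_eval map_polyC hornerC.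
have gX : g (frac 'X) = X by rewrite gE /= /horner_eval map_polyX hornerX.
pose Y := model_y irr t' d' + c e.
have c2 : 2%N \in [pchar ffield C'] by rewrite inE /= (rmorph_two char2 c) eqxx.
have modelY : root (map_poly g (model s t d)) Y.
  have h0 : g' (frac h) != 0 by rewrite fmorph_eq0 tofrac_eq0 irredp_neq0.
  have rhsE : g (rhs s t d) = g' (rhs s t' d') + c (e ^+ 2 + e).
    apply: (mulIf h0).
    have := rhs_form irr gc t d (p := num i) (q := den i).
    rewrite gX XE cubic_form_Gamma // => -> //; rewrite -rel.
    rewrite mulrDl -rmorphM (rhs_eq irr) -[c _]/(g' (frac (e ^+ 2 + e)%:P)) -rmorphM.
    rewrite -tofracM -rmorphD -tofracD; congr (g' (frac _)).
    by rewrite -mul_polyC !polyCD !mulrDl !addrA.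
  apply: root_model; rewrite rhsE (rmorphD c) (rmorphXn c).
  by have := artin_schreier_shift c2 (c e) (model_curve_is_model irr t' d').2.
have [f [fg fY]] := lift_qfpoly (model_irreducible irr t d) modelY.
have fc a : f (fconst C a) = c a by rewrite [LHS]fg -gc.
have fx : f (model_x irr t d) = X by rewrite [LHS]fg gX.
have fev p z : f (map_poly (fconst C) p).[z] = (map_poly c p).[f z].
  rewrite -horner_map -map_poly_comp; congr (_.[_]).
  by apply: eq_map_poly => a /=; rewrite fc.
(* The inverse transformation applied to the coordinate x of [C]: a preimage of x', needed for
   surjectivity. *)
pose xi := (map_poly (fconst C) (num j)).[model_x irr t d] /
           (map_poly (fconst C) (den j)).[model_x irr t d].
have fxi : f xi = x' by rewrite fmorph_div !fev fx -x'E.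
have f_kx r : exists z, f z = g' r.
  have [u [v [v0 E]]] := fracP r.
  exists ((map_poly (fconst C) u).[xi] / (map_poly (fconst C) v).[xi]).
  have gv0 : g' (frac v) != 0 by rewrite fmorph_eq0 tofrac_eq0.
  rewrite fmorph_div !fev fxi -!g'E -E rmorphM; exact: mulfK gv0 _.
have fsurj z : exists z', f z' = z.
  have [c0 [c1 ->]] := (model_curve_is_model irr t' d').1 z.
  have [z0 E0] := f_kx c0; have [z1 E1] := f_kx c1.
  exists (z0 + z1 * (model_y irr t d - fconst C e)).
  rewrite rmorphD rmorphM E0 E1; congr (_ + _ * _).
  by rewrite rmorphB [f (model_y _ _ _)]fY fc /Y addrK.
have [F FE] := curve_iso_of_rmorphism fc fsurj.
by exists F; rewrite !FE fx XE; split=> //; rewrite [LHS]fY.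
Qed.

End Existence.

(** * Moebius transformations of the function field *)

Section Moebius.
Local Open Scope quotient_scope.
Variables (k : fieldType) (C : curve k).
Local Notation c := (fconst C).
Implicit Types (A B : GL2 k) (z : ffield C).

Definition moebius_mx (A : 'M[k]_2) z :=
  (c (A 0 0) * z + c (A 0 1)) / (c (A 1 0) * z + c (A 1 1)).

Lemma moebius_mxZ a (A : 'M[k]_2) z :
  a != 0 -> moebius_mx (a *: A) z = moebius_mx A z.
Proof.
move=> a0; have ca0 : c a != 0 by rewrite fmorph_eq0.
rewrite /moebius_mx !mxE !(rmorphM c) -!mulrA -!mulrDr invfM mulrACA.
by rewrite (divff ca0) mul1r.
Qed.

Lemma mobiusE (g : PGL2 k) z : mobius g z = moebius_mx (val (repr g)) z.
Proof. by []. Qed.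

Lemma mobius_pi A z : mobius (\pi_(PGL2 k) A) z = moebius_mx (val A) z.
Proof.
have [a E] := PGL2_reprP A; rewrite mobiusE E moebius_mxZ //.
apply/eqP=> a0; have := valP (repr (\pi_(PGL2 k) A)).
by rewrite E a0 scale0r unitmxE det0 unitr0.
Qed.

(** For nonconstant [z] the inner denominator is nonzero: it could vanish only for a constant [z] or
    a zero second row. It then cancels from the composite even where the outer denominator is
    zero. *)
Lemma mobius_mul (g h : PGL2 k) z : (forall a, z <> c a) ->
  mobius (g * h)%g z = mobius g (mobius h z).
Proof.
move=> z_nc; rewrite -[X in mobius X z]/(PGL2_mul g h) mobius_pi !mobiusE.
rewrite -[val (GL2_mul _ _)]/(val (repr g) *m val (repr h)).
have := valP (repr h); move: (val (repr g)) (val (repr h)) => A B uB.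
have sum2 (F : 'I_2 -> k) : \sum_i F i = F 0 + F 1.
  by rewrite !big_ord_recl big_ord0 addr0; congr (_ + F _); apply: val_inj.
rewrite /moebius_mx !mxE !sum2.
have den0 : c (B 1 0) * z + c (B 1 1) != 0.
  apply/eqP => E; have [B10|B10] := eqVneq (B 1 0) 0.
    have B11 : B 1 1 = 0.
      by apply/eqP; rewrite -(fmorph_eq0 c); move: E; rewrite B10 rmorph0 mul0r add0r => ->.
    have rB : row 1 B = 0.
      apply/rowP=> j; rewrite !mxE; case: j => [[|[|//]] lti].
        by rewrite -[RHS]B10; congr (B _ _); apply: val_inj.
      by rewrite -[RHS]B11; congr (B _ _); apply: val_inj.
    have : row 1 B *m invmx B = 0 by rewrite rB mul0mx.
    rewrite -row_mul mulmxV // => /rowP/(_ 1); rewrite !mxE /= => /eqP.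
    by rewrite oner_eq0.
  apply: (z_nc (- B 1 1 / B 1 0)); rewrite fmorph_div rmorphN.
  have cB0 : c (B 1 0) != 0 by rewrite fmorph_eq0.
  by apply: (mulIf cB0); rewrite divfK // mulrC; apply/eqP; rewrite -addr_eq0 E.
move: den0; rewrite !(rmorphD c) !(rmorphM c).
move: (c (A 0 0)) (c (A 0 1)) (c (A 1 0)) (c (A 1 1)).
move: (c (B 0 0)) (c (B 0 1)) (c (B 1 0)) (c (B 1 1)).
move=> b00 b01 b10 b11 a00 a01 a10 a11 den0.
have E u v : u * ((b00 * z + b01) / (b10 * z + b11)) + v =
    ((u * b00 + v * b10) * z + (u * b01 + v * b11)) / (b10 * z + b11).
  by field.
by rewrite !E [in RHS]invfM mulrACA invrK mulVf // mulr1.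
Qed.

Lemma mobius1 z : mobius 1%g z = z.
Proof.
rewrite -[X in mobius X z]/(PGL2_one k) mobius_pi /moebius_mx /= !mxE /=.
by rewrite !(rmorph0 c) !(rmorph1 c) mul1r addr0 mul0r add0r divr1.
Qed.

Lemma pullback_mobius (D : curve k) (phi : curve_iso D C) (g : PGL2 k) z :
  pullback phi (mobius g z) = mobius g (pullback phi z).
Proof.
have [f fE] := pullback_rmorphism phi.
by rewrite -!fE /mobius fmorph_div !rmorphD !rmorphM !fE !(ci_const (curve_isoP phi)).
Qed.

Lemma mobius_pgl (rows : seq (seq k)) (A := mx_of_rows 2 2 rows) z :
  A \in unitmx -> mobius (pgl A) z = moebius_mx A z.
Proof. by move=> uA; rewrite (pglE uA) mobius_pi. Qed.

End Moebius.

Lemma eq_cross (L : comPzRingType) (z n n' m m' : L) :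
  z * m = n -> z * m' = n' -> n * m' = n' * m.
Proof. by move=> <- <-; rewrite mulrAC. Qed.

Lemma is_model_comp (k L L' : fieldType) (s : k)
    (g : {rmorphism {fraction {poly k}} -> L}) (f : {rmorphism L -> L'}) y t d :
  is_model s g y t d -> (forall z, exists z', f z' = z) ->
  is_model s (f \o g) (f y) t d.
Proof.
move=> [sp yE] fsurj; split=> [z|]; last by rewrite /= -yE rmorphD rmorphXn.
have [z' <-] := fsurj z; have [c0 [c1 ->]] := sp z'.
by exists c0, c1; rewrite rmorphD rmorphM.
Qed.

Lemma model_rmorph_eq (k L L' : fieldType) (s : k)
    (g : {rmorphism {fraction {poly k}} -> L}) y t d (F G : {rmorphism L -> L'}) :
  is_model s g y t d ->
  (forall a, F (g (tofrac a%:P)) = G (g (tofrac a%:P))) ->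
  F (g (tofrac 'X)) = G (g (tofrac 'X)) -> F y = G y -> F =1 G.
Proof.
move=> [sp _] FGc FGx FGy.
have FGp p : F (g (tofrac p)) = G (g (tofrac p)).
  have := horner_frac (F \o g) p; have := horner_frac (G \o g) p.
  rewrite /= FGx => -> ->.
  by congr (_.[_]); apply: eq_map_poly => a; apply: FGc.
have FGr r : F (g r) = G (g r).
  have [u [v [v0 E]]] := fracP r.
  have v0' : F (g (tofrac v)) != 0 by rewrite !fmorph_eq0 tofrac_eq0.
  by apply: (mulIf v0'); rewrite [in RHS]FGp -!rmorphM E FGp.
by move=> z; have [c0 [c1 ->]] := sp z; rewrite !rmorphD !rmorphM !FGr FGy.
Qed.

(** * Isomorphisms of model curves in terms of Gamma *)

Section GammaAction.
Local Open Scope quotient_scope.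
Variables (k : fieldType) (char2 : 2%N \in [pchar k]).
Variables (s w : k) (irr : irreducible_poly (cubic s)) (hs : s = 1 + w + w ^+ 2).
Implicit Types (t : nz_triple k) (d e : k) (i j : 'I_3).
Local Notation frac := (@tofrac {poly k}).
Local Notation h := (cubic s).
Local Notation num := (Gamma_num s w).
Local Notation den := (Gamma_den w).
Local Notation gam := (Gamma_elt s w).
Local Notation curve t d := (model_curve irr t d).
Local Notation x t d := (model_x irr t d).
Local Notation y t d := (model_y irr t d).

Lemma mobius_Gamma (C : Defs.curve k) (z : ffield C) i :
  mobius (gam i) z =
  (map_poly (fconst C) (num i)).[z] / (map_poly (fconst C) (den i)).[z].
Proof.
case: i => [[|[|[|//]]] lti]; rewrite /Gamma_elt /Gamma_num /Gamma_den /=.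
- by rewrite mobius1 rmorph1 map_polyX hornerX hornerC divr1.
- rewrite mobius_pgl ?(mx1_unit char2 hs) // /moebius_mx !mxE /=.
  rewrite !(rmorphD, rmorphM, rmorph1) /= !map_polyC map_polyX !hornerE.
  by [].
rewrite mobius_pgl ?(mx2_unit char2 hs) // /moebius_mx !mxE /=.
rewrite !(rmorphD, rmorphM, rmorph1) /= !map_polyC map_polyX !hornerE.
by [].
Qed.

Lemma mobius_x t d i :
  mobius (gam i) (x t d) * model_frac irr t d (frac (den i)) =
  model_frac irr t d (frac (num i)).
Proof.
have D0 : model_frac irr t d (frac (den i)) != 0.
  by rewrite fmorph_eq0 tofrac_eq0 Gamma_den_neq0.
rewrite mobius_Gamma -!model_frac_poly; exact: divfK.
Qed.

Lemma mobius_x_inj t d g g' : g \in Gamma s w -> g' \in Gamma s w ->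
  mobius g (x t d) = mobius g' (x t d) -> g = g'.
Proof.
move=> /GammaE[i ->] /GammaE[j ->] E.
have {}E : num i * den j = num j * den i.
  have Ej := mobius_x t d j; rewrite -E in Ej.
  have := eq_cross (mobius_x t d i) Ej; rewrite -!rmorphM => /fmorph_inj/eqP.
  by rewrite tofrac_eq => /eqP.
congr (gam _).
(* The pairs of leading coefficients are the images of the point at infinity, namely infinity, w and
   1 + w; they are distinct, and the coefficient of degree two of the cross products detects
   this. *)
pose n1 (i : 'I_3) := nth 0 [:: 1; w; 1 + w] i.
pose d1 (i : 'I_3) := nth 0 [:: 0; 1; 1] i : k.
have numE l : exists a, num l = (n1 l)%:P * 'X + a%:P.
  case: l => [[|[|[|//]]] ltl]; rewrite /Gamma_num /n1 /=.
  - by exists 0; rewrite polyC1 polyC0 mul1r addr0.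
  - by exists s.
  by exists s; rewrite polyCD polyC1.
have denE l : exists a, den l = (d1 l)%:P * 'X + a%:P.
  case: l => [[|[|[|//]]] ltl]; rewrite /Gamma_den /d1 /=.
  - by exists 1; rewrite polyC0 mul0r add0r polyC1.
  - by exists (w + 1); rewrite polyC1 mul1r polyCD polyC1 addrA.
  by exists w; rewrite polyC1 mul1r.
have coef2 l m : (num l * den m)`_2 = n1 l * d1 m.
  have [a ->] := numE l; have [b ->] := denE m.
  have -> : ((n1 l)%:P * 'X + a%:P) * ((d1 m)%:P * 'X + b%:P) =
      (n1 l * d1 m)%:P * 'X^2 + (n1 l * b + a * d1 m)%:P * 'X + (a * b)%:P.
    by rewrite polyCD !polyCM; ring.
  by rewrite !coefE /= mulr1 !mulr0 !addr0.
have := congr1 (fun p : {poly k} => p`_2) E; rewrite !coef2.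
case: i j {E} => [[|[|[|//]]] lti] [[|[|[|//]]] ltj]; rewrite /n1 /d1 /=;
  rewrite ?(mulr1, mulr0) => E; try exact: val_inj; case/eqP: (oner_neq0 k).
- by [].
- by [].
- by [].
- by apply: (@addIr _ w); rewrite add0r.
- by [].
by apply: (@addIr _ w); rewrite add0r.
Qed.

Lemma x_nonconstant t d a : x t d <> fconst (curve t d) a.
Proof.
move=> E; apply: (@model_x_transcendental _ _ irr t d); rewrite E.
exact: algebraic_id.
Qed.

(** Pulling back the model of the target gives a second model of the function field of the source,
    to which [model_compare] applies. *)
Lemma curve_iso_classify t t' d d' (phi : curve_iso (curve t' d') (curve t d)) :
  exists i e, [/\ quad t' + (d' + (e ^+ 2 + e))%:P * h =
      row_form (val t) (num i) (den i) * den i + d%:P * h,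
    pullback phi (x t d) = mobius (gam i) (x t' d') &
    pullback phi (y t d) = y t' d' + fconst (curve t' d') e].
Proof.
have [f fE] := pullback_rmorphism phi.
pose h1 : {rmorphism {fraction {poly k}} -> ffield (curve t' d')} :=
  f \o model_frac irr t d.
have gh a : model_frac irr t' d' (frac a%:P) = h1 (frac a%:P).
  by rewrite [RHS]fE [RHS](ci_const (curve_isoP phi)).
have [f' _ f'K] := ci_bij (curve_isoP phi).
have mod2 : is_model s h1 (pullback phi (y t d)) t d.
  rewrite -fE; apply: is_model_comp (model_curve_is_model irr t d) _ => z.
  exists (f' z); rewrite fE; exact: f'K.
have [i [e [Xi yE rel]]] :=
  model_compare char2 irr hs gh (model_curve_is_model irr t' d') mod2.
exists i, e; split=> //.
have D0 : model_frac irr t' d' (frac (den i)) != 0.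
  by rewrite fmorph_eq0 tofrac_eq0 Gamma_den_neq0.
by apply: (mulIf D0); rewrite mobius_x -Xi -fE.
Qed.

Lemma curve_iso_construct i e t t' d d' :
  quad t' + (d' + (e ^+ 2 + e))%:P * h =
    row_form (val t) (num i) (den i) * den i + d%:P * h ->
  exists phi : curve_iso (curve t' d') (curve t d),
    pullback phi (x t d) = mobius (gam i) (x t' d') /\
    pullback phi (y t d) = y t' d' + fconst (curve t' d') e.
Proof.
move/(model_iso_exists char2 irr hs) => [phi [xE yE]]; exists phi; split=> //.
have D0 : model_frac irr t' d' (frac (den i)) != 0.
  by rewrite fmorph_eq0 tofrac_eq0 Gamma_den_neq0.
by apply: (mulIf D0); rewrite mobius_x -xE.
Qed.

(** The images of x and y determine the pullback, and the pullback determines the map on points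
    because a point is the set of functions regular at it. *)
Lemma model_curve_iso_eq t t' d d' (f g : curve_iso (curve t' d') (curve t d)) :
  pullback f (x t d) = pullback g (x t d) ->
  pullback f (y t d) = pullback g (y t d) -> f = g.
Proof.
move=> xE yE; have [F FE] := pullback_rmorphism f.
have [G GE] := pullback_rmorphism g.
have pE : pullback f =1 pullback g.
  move=> z; rewrite -FE -GE.
  apply: (model_rmorph_eq (model_curve_is_model irr t d)) => [a||].
  - by rewrite FE GE [LHS](ci_const (curve_isoP f)) [RHS](ci_const (curve_isoP g)).
  - by rewrite FE GE.
  by rewrite FE GE.
apply: curve_iso_eq => // P; apply: point_eq => z.
have := ci_regular (curve_isoP f) z P; have := ci_regular (curve_isoP g) z P.
by rewrite /Defs.regular pE => H1 H2; split=> [/H2/H1|/H1/H2].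
Qed.

Lemma isomorphicP t t' d d' :
  isomorphic (curve t' d') (curve t d) <->
  exists2 g, g \in Gamma s w & param char2 t' d' = act s w (param char2 t d) g.
Proof.
split=> [[phi]|[g /GammaE[i ->]]].
  have [i [e [rel _ _]]] := curve_iso_classify phi.
  exists (gam i); first by apply/GammaE; exists i.
  by apply/(param_act char2 hs); exists e.
move/(param_act char2 hs) => [e /curve_iso_construct[phi _]]; exact: inhabits phi.
Qed.

End GammaAction.

(** * Isotropy groups and the exact sequence *)

Lemma bundle_multiplicative (G H : groupType) (f : G -> H) :
  {morph f : a b / (a * b)%g} -> exists F : {multiplicative G -> H}, F =1 f.
Proof.
move=> fM.
pose F : {multiplicative G -> H} := HB.pack f (isMultiplicative.Build G H f fM).
by exists F.
Qed.

Section Isotropy.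
Local Open Scope quotient_scope.
Variables (k : fieldType) (char2 : 2%N \in [pchar k]).
Variables (s w : k) (irr : irreducible_poly (cubic s)) (hs : s = 1 + w + w ^+ 2).
Implicit Types (t : nz_triple k) (d e : k) (i j : 'I_3).

Lemma actM_fixP t d (n := param char2 t d)
    (a := val t 0 0) (b := val t 0 1) (c := val t 0 2) :
  actM w n = n <-> a = b /\ c = a * (1 + s).
Proof.
have r1 : val t 0 (lift ord0 ord0) = b by congr (val t _ _); apply: val_inj.
have r2 : val t 0 (lift ord0 (lift ord0 ord0)) = c.
  by congr (val t _ _); apply: val_inj.
have r0 : val t 0 ord0 = a by [].
have E1 := actM1 w n; have E2 := actM2 w n.
split=> [fix_n|[ab cE]].
  move: E1; rewrite fix_n => E1.
  have Ea : a = a * (w ^+ 2 + w ^+ 3) + b * (1 + w + w ^+ 2) + c * (1 + w).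
    have := congr1 (fun r : 'rV[k]_3 => r 0 0) E1.
    by rewrite !mxE !big_ord_recl !big_ord0 !mxE /= r0 r1 r2 addr0 !addrA.
  have Eb : b = a * (1 + w ^+ 3) + b * w ^+ 2 + c * w.
    have := congr1 (fun r : 'rV[k]_3 => r 0 1) E1.
    by rewrite !mxE !big_ord_recl !big_ord0 !mxE /= r0 r1 r2 addr0 !addrA.
  have ab : a = b.
    apply: (eq_pchar2 char2).
    (* This combination of the first two fixed-point equations eliminates c, whose coefficients are
       1 + w and w. *)
    have : (1 + w) * (b + (a * (1 + w ^+ 3) + b * w ^+ 2 + c * w)) +
        w * (a + (a * (w ^+ 2 + w ^+ 3) + b * (1 + w + w ^+ 2) + c * (1 + w))) = 0.
      by rewrite -Ea -Eb !(addrr_pchar2 char2) !mulr0 addr0.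
    by move=> <-; char2_ring char2.
  split=> //; apply: (eq_pchar2 char2).
  (* In the sum of the two equations c has coefficient 1. *)
  have : (b + (a * (1 + w ^+ 3) + b * w ^+ 2 + c * w)) +
      (a + (a * (w ^+ 2 + w ^+ 3) + b * (1 + w + w ^+ 2) + c * (1 + w))) = 0.
    by rewrite -Ea -Eb !(addrr_pchar2 char2).
  by move=> <-; rewrite -ab hs; char2_ring char2.
(* The increment of the fourth coordinate vanishes in k itself, not just modulo [AS]. *)
have lE : (val n.1 *m ursubmx (M w)) 0 0 = 0.
  rewrite !mxE !big_ord_recl !big_ord0 !mxE /= r0 r1 r2 cE -ab hs.
  char2_ring char2.
apply: injective_projections; last by rewrite E2 lE raddf0 add0r.
apply: val_inj; rewrite E1 /=; apply/rowP => j.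
rewrite !mxE !big_ord_recl !big_ord0 !mxE r0 r1 r2 /=.
case: j => [[|[|[|//]]] ltj]; rewrite /= ?cE -?ab ?hs.
- transitivity a; last by congr (val t _ _); apply: val_inj.
  by char2_ring char2.
- transitivity b; last by congr (val t _ _); apply: val_inj.
  by rewrite -ab; char2_ring char2.
transitivity c; last by congr (val t _ _); apply: val_inj.
by rewrite cE hs; char2_ring char2.
Qed.

Lemma isotropy_trivial n : ~ (actM w n = n) ->
  forall g, g \in isotropy (char2 := char2) hs n -> g = 1%g.
Proof. by move=> nfix g /isotropyP[//|[_ /nfix]]. Qed.

Lemma isotropy_Gamma n g : actM w n = n ->
  (g \in isotropy (char2 := char2) hs n) = (g \in Gamma s w).
Proof.
move=> fix_n; apply/isotropyP/idP => [[->|[]//]|Gg]; last by right.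
exact/GammaP/Or31.
Qed.

Lemma isotropy_cyclic n : actM w n = n ->
  group_isomorphic (subgrp (isotropy (char2 := char2) hs n)) 'Z_3.
Proof.
move=> fix_n; have isoG := isotropy_Gamma _ fix_n.
have Gi i : Gamma_elt s w i \in isotropy hs n.
  by rewrite isoG; apply/GammaE; exists i.
pose f (u : subgrp (isotropy hs n)) : 'Z_3 :=
  if val u == 1%g then 0 else if val u == gamma1 s w then 1 else 2%:R.
have g1 := gamma1_neq1 char2 hs; have [g21 g2g1] := gamma2_neq char2 hs.
have uE (u : subgrp (isotropy hs n)) :
    [\/ val u = 1%g, val u = gamma1 s w | val u = gamma2 s w].
  by apply/GammaP; rewrite -isoG; apply: valP.
have f1 u : val u = 1%g -> f u = 0 by rewrite /f => ->; rewrite eqxx.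
have f2 u : val u = gamma1 s w -> f u = 1.
  by rewrite /f => ->; rewrite (negPf g1) eqxx.
have f3 u : val u = gamma2 s w -> f u = 2%:R.
  by rewrite /f => ->; rewrite (negPf g21) (negPf g2g1).
have [|F FE] := @bundle_multiplicative _ _ f.
  move=> u v; have vM : val (u * v)%g = (val u * val v)%g by [].
  have [uE1|uE1|uE1] := uE u; have [vE1|vE1|vE1] := uE v;
    move: vM; rewrite uE1 vE1 ?mul1g ?mulg1 ?(gamma11 char2 hs)
      ?(gamma12 char2 hs) ?(gamma21 char2 hs) ?(gamma22 char2 hs);
    move=> vM; rewrite ?(f1 u uE1) ?(f2 u uE1) ?(f3 u uE1) ?(f1 v vE1)
      ?(f2 v vE1) ?(f3 v vE1) ?(f1 _ vM) ?(f2 _ vM) ?(f3 _ vM); exact: val_inj.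
exists F; exists (fun i : 'Z_3 => Subgrp (Gi i)) => [u|i]; rewrite FE.
  apply: val_inj => /=; have [E|E|E] := uE u; rewrite E.
  - by rewrite (f1 _ E).
  - by rewrite (f2 _ E).
  by rewrite (f3 _ E).
case: i => [[|[|[|//]]] lti].
- by rewrite f1 //; apply: val_inj.
- by rewrite f2 //; apply: val_inj.
by rewrite f3 //; apply: val_inj.
Qed.

End Isotropy.

(** * The split exact sequence of automorphisms *)

Section Automorphisms.
Variables (k : fieldType) (char2 : 2%N \in [pchar k]).
Variables (s w : k) (irr : irreducible_poly (cubic s)) (hs : s = 1 + w + w ^+ 2).
Variables (t : nz_triple k) (d : k).
Local Notation C := (model_curve irr t d).
Local Notation x := (model_x irr t d).
Local Notation y := (model_y irr t d).
Local Notation n := (param char2 t d).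
Local Notation H := (subgrp (isotropy hs n)).

Lemma isotropy_sub g : g \in isotropy hs n -> g \in Gamma s w.
Proof. by move=> /isotropyP[->|[]//]; apply/GammaP/Or31. Qed.

(** It arises from the identity of Gamma with the translation e = 1, which preserves d because 1^2 +
    1 = 0. *)
Lemma hyperelliptic_involution :
  exists iota : Aut C, pullback iota x = x /\ pullback iota y = y + 1.
Proof.
pose i0 : 'I_3 := Ordinal (isT : (0 < 3)%N).
have [|phi [xE yE]] := @curve_iso_construct _ char2 s w irr hs i0 1 t t d d.
  rewrite /Gamma_num /Gamma_den /= mulr1 -quadE expr1n.
  by rewrite (addrr_pchar2 char2) addr0.
exists phi; split; first by rewrite xE /Gamma_elt /= mobius1.
have e1 : fconst C 1 = 1 := rmorph1 (fconst C).
exact (etrans yE (congr1 (fun z => y + z) e1)).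
Qed.

Lemma Aut_mobius (phi : Aut C) :
  exists u : H, pullback phi x = mobius (val u) x.
Proof.
have [i [e [rel xE _]]] := curve_iso_classify char2 hs phi.
have Gi : Gamma_elt s w i \in isotropy hs n.
  apply/andP; split; first by apply/GammaE; exists i.
  by apply/eqP/esym/(param_act char2 hs); exists e.
by exists (Subgrp Gi).
Qed.

Lemma mobius_H_inj (u v : H) : mobius (val u) x = mobius (val v) x -> u = v.
Proof.
by move/(mobius_x_inj char2 hs) => E; apply/val_inj/E; apply: isotropy_sub; apply: valP.
Qed.

(** Pullback reverses composition, but it commutes with Moebius transformations, which reverses the
    order once more; so the result is a homomorphism and not an antihomomorphism. *)
Lemma Aut_mobius_hom : exists p : {multiplicative Aut C -> H},
  forall phi, pullback phi x = mobius (val (p phi)) x.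
Proof.
have [p pE] := choice Aut_mobius.
have [|P PE] := @bundle_multiplicative (Aut C) H p; last first.
  by exists P => phi; rewrite PE.
move=> f g; apply: mobius_H_inj; rewrite -pE.
have E := mobius_mul (val (p f)) (val (p g)) (@x_nonconstant _ _ irr t d).
apply: etrans (esym E); have -> : pullback (f * g)%g x = pullback g (pullback f x) by [].
exact (etrans (congr1 (pullback g) (pE f))
  (etrans (pullback_mobius g _ _) (congr1 (mobius _) (pE g)))).
Qed.

Section Sequence.
Variables (iota : Aut C) (p : {multiplicative Aut C -> H}).
Hypotheses (iota_x : pullback iota x = x) (iota_y : pullback iota y = y + 1).
Hypothesis pE : forall phi, pullback phi x = mobius (val (p phi)) x.
Local Open Scope group_scope.

(** Such an automorphism fixes x and sends y to y + e; the equation of the curve forces e^2 + e = 0,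
    so e is 0 or 1. *)
Lemma ker_p phi : p phi = 1 -> phi = 1 \/ phi = iota.
Proof.
move=> p1; have [i [e [rel xE yE]]] := curve_iso_classify char2 hs phi.
have xfix : pullback phi x = x by rewrite pE p1 mobius1.
have i1 : Gamma_elt s w i = 1.
  apply: (@mobius_x_inj _ char2 s w irr hs t d); first by apply/GammaE; exists i.
    exact/GammaP/Or31.
  by rewrite mobius1 -xE.
have i0 : i = Ordinal (isT : (0 < 3)%N).
  apply: val_inj; move: i1; have g1 := gamma1_neq1 char2 hs.
  have [g2 _] := gamma2_neq char2 hs.
  case: i {rel xE} => [[|[|[|//]]] lti] //; rewrite /Gamma_elt /= => /eqP.
    by rewrite (negPf g1).
  by rewrite (negPf g2).
have : e = 0%R \/ e = 1%R.
  move: rel; rewrite i0 /Gamma_num /Gamma_den /= mulr1 quadE.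
  move/row_formD_inj=> [_ /eqP]; rewrite -subr_eq0 addrAC subrr add0r.
  rewrite -[X in (_ + X)%R]mulr1 expr2 -mulrDr mulf_eq0 => /orP[]/eqP E.
    by left.
  by right; apply: (eq_pchar2 char2).
case=> eE; [left|right]; apply: model_curve_iso_eq.
- by [].
- by rewrite yE eE rmorph0 addr0.
- by rewrite xfix iota_x.
by rewrite yE eE rmorph1 iota_y.
Qed.

Lemma p_iota : p iota = 1.
Proof. by apply: mobius_H_inj; rewrite -pE iota_x mobius1. Qed.

Lemma iota_sqr : iota * iota = 1.
Proof.
have [F FE] := pullback_rmorphism iota.
have pbM z : pullback (iota * iota) z = pullback iota (pullback iota z) by [].
apply: model_curve_iso_eq; rewrite pbM ?iota_x ?iota_y //.
rewrite -FE rmorphD rmorph1 FE iota_y -addrA.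
have -> : (1 + 1 = fconst C (1 + 1) :> ffield C)%R by rewrite rmorphD rmorph1.
by rewrite (addrr_pchar2 char2) rmorph0 addr0.
Qed.

Lemma p_surj u : exists phi, p phi = u.
Proof.
have /isotropy_sub/GammaE[i uE] := valP u.
have /andP[_ /eqP] := valP u; rewrite uE => /esym/(param_act char2 hs)[e rel].
have [phi [xE _]] := curve_iso_construct char2 irr hs rel.
by exists phi; apply: mobius_H_inj; rewrite -pE xE uE.
Qed.

Lemma p_section : exists sec : {multiplicative H -> Aut C}, forall u, p (sec u) = u.
Proof.
have g1 := gamma1_neq1 char2 hs; have [g21 g2g1] := gamma2_neq char2 hs.
have pM (f g : Aut C) : p (f * g) = p f * p g by apply: gmulfM.
have p1 : p 1 = 1 by apply: (mulgI (p 1)); rewrite -pM !mulg1.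
have uE (u : H) : [\/ val u = 1, val u = gamma1 s w | val u = gamma2 s w].
  by apply/GammaP/isotropy_sub; apply: valP.
(* Without [gamma1] the isotropy group is trivial, since [gamma1] is the square of [gamma2]. *)
have [G1|nG1] := boolP (gamma1 s w \in isotropy hs n); last first.
  have u1 (u : H) : u = 1.
    apply: val_inj; have [//|E|E] := uE u; case/negP: nG1; first by rewrite -E; exact: valP.
    have -> : gamma1 s w = val (u * u) by rewrite /= E gamma22.
    exact: valP.
  have [|sec secE] := @bundle_multiplicative H (Aut C) (fun=> 1).
    by move=> u v; rewrite mulg1.
  by exists sec => u; rewrite secE p1 [u]u1.
pose v : H := Subgrp G1.
have [b0 pb0] := p_surj v.
have v3 : v * v * v = 1 by apply: val_inj; rewrite /= gamma11 // gamma21.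
have [c cE] : exists c, c = b0 * b0 * b0 by exists (b0 * b0 * b0).
have c2 : c * c = 1.
  have : p c = 1 by rewrite cE !pM pb0.
  by case/ker_p => ->; rewrite ?mulg1 ?iota_sqr.
have b0c : b0 * c = c * b0 by rewrite cE !mulgA.
(* The cube of a lift of the generator is 1 or the involution, so the fourth
   power of that lift has order three. *)
have [b [b3 pb]] : exists b, b * b * b = 1 /\ p b = v.
  exists (b0 * c); split; last by rewrite pM pb0 cE !pM pb0 v3 mulg1.
  have -> : b0 * c * (b0 * c) = b0 * b0.
    by rewrite {2}b0c mulgA -(mulgA b0 c c) c2 mulg1.
  by rewrite mulgA -cE c2.
pose f (u : H) : Aut C :=
  if val u == 1 then 1 else if val u == gamma1 s w then b else b * b.
have f1 u : val u = 1 -> f u = 1 by rewrite /f => ->; rewrite eqxx.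
have f2 u : val u = gamma1 s w -> f u = b.
  by rewrite /f => ->; rewrite (negPf g1) eqxx.
have f3 u : val u = gamma2 s w -> f u = b * b.
  by rewrite /f => ->; rewrite (negPf g21) (negPf g2g1).
have [|sec secE] := @bundle_multiplicative H (Aut C) f.
  move=> u u'; have vM : val (u * u') = val u * val u' by [].
  have [E|E|E] := uE u; have [E'|E'|E'] := uE u';
    move: vM; rewrite E E' ?mul1g ?mulg1 ?(gamma11 char2 hs)
      ?(gamma12 char2 hs) ?(gamma21 char2 hs) ?(gamma22 char2 hs);
    move=> vM; rewrite ?(f1 u E) ?(f2 u E) ?(f3 u E) ?(f1 u' E')
      ?(f2 u' E') ?(f3 u' E') ?(f1 _ vM) ?(f2 _ vM) ?(f3 _ vM)
      ?mul1g ?mulg1 ?mulgA ?b3 ?mul1g //.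
exists sec => u; rewrite secE; apply: val_inj; have [E|E|E] := uE u.
- by rewrite (f1 _ E) p1 E.
- by rewrite (f2 _ E) pb E.
by rewrite (f3 _ E) pM pb E /= gamma11.
Qed.

Lemma Aut_split_exact : split_exact (val : subgrp (cyc iota) -> Aut C) p.
Proof.
have pM (f g : Aut C) : p (f * g) = p f * p g by apply: gmulfM.
have p1 : p 1 = 1 by apply: (mulgI (p 1)); rewrite -pM !mulg1.
split; [exact: val_inj | | exact: p_surj | exact: p_section].
have iotaP : iota \in cyc iota by apply/asboolP.
move=> phi; split=> [/ker_p[->|->]|[[g gP] ->]].
- by exists 1.
- by exists (Subgrp iotaP).
(* An element of the group generated by [iota] lies in every subgroup containing [iota], in
   particular in the kernel of [p]. *)
have /asboolP/(_ [pred f | p f == 1]) := gP.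
rewrite !inE => gS; apply/eqP/gS; last by rewrite p_iota.
split=> [|f g']; first by rewrite inE; apply/eqP.
rewrite !inE => /eqP pf /eqP pg; apply/eqP.
have pgV : p g'^-1 = 1 by apply: (mulgI (p g')); rewrite -pM mulgV p1 pg mulg1.
by rewrite pM pf pgV mulg1.
Qed.

End Sequence.
End Automorphisms.

Theorem proposition12 (k : fieldType) (char2 : 2%N \in [pchar k])
    (perf : perfect_field k) (s w : k)
    (irr : irreducible_poly (cubic s)) (hs : s = 1 + w + w ^+ 2) :
  (forall (t t' : nz_triple k) (d d' : k),
     isomorphic (model_curve irr t' d') (model_curve irr t d) <->
     exists2 g, g \in Gamma s w
              & param char2 t' d' = act s w (param char2 t d) g)
  /\
  (forall (t : nz_triple k) (d : k),
     let C := model_curve irr t d in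
     let x := model_x irr t d in
     let y := model_y irr t d in
     let n := param char2 t d in
     let a := val t 0 0 in let b := val t 0 1 in let c := val t 0 2 in
     (exists (iota : Aut C)
             (p : {multiplicative Aut C -> subgrp (isotropy hs n)}),
        [/\ pullback iota x = x /\ pullback iota y = y + 1,
            forall phi, pullback phi x = mobius (val (p phi)) x
          & split_exact (val : subgrp (cyc iota) -> Aut C) p])
     /\ (a = b /\ c = a * (1 + s) ->
           group_isomorphic (subgrp (isotropy hs n)) 'Z_3)
     /\ (~ (a = b /\ c = a * (1 + s)) ->
           forall g, g \in isotropy hs n -> g = 1%g)).
Proof.
split=> [t t' d d'|t d C x y n a b c]; first exact: isomorphicP.
split; last split.
- have [iota [iota_x iota_y]] := hyperelliptic_involution char2 irr hs t d.
  have [p pE] := Aut_mobius_hom char2 irr hs t d.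
  by exists iota, p; split=> //; apply: Aut_split_exact.
- by move/(actM_fixP char2 hs t d); apply: isotropy_cyclic.
by move=> nab; apply: isotropy_trivial => /(actM_fixP char2 hs t d).
Qed.
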